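(* Let $R$ be an integral domain with field of fractions $K$, and let $h:R\to[0,\infty)$ be a height function of $\theta$-type for some $\theta:\mathbb N\to\mathbb N$. For all integers $n\ge 1$, $D\ge 1$, $H\ge 1$ there exist constants $c_1=c_1(n,D)$, depending only on $n,D$, and $c_2=c_2(n,D,H,\theta)$, depending only on $n,D,H,\theta$, such that the following holds: if $f_1,\dots,f_s\in R[X_1,\dots,X_n]$ have no common zero in $K^{alg}$, $\deg(f_i)\le D$ and $h(f_i)\le H$ for all $i$, then there exist a nonzero $a\in R$ and $h_1,\dots,h_s\in R[X_1,\dots,X_n]$ such that (i) $a=f_1h_1+\dots+f_sh_s$; (ii) $\deg(h_i)\le c_1$ for all $i$; (iii) $h(a)\le c_2$ and $h(h_i)\le c_2$ for all $i$; (iv) if moreover $R$ is a UFD with the p-property and $h(x)=|x|$ is the absolute value of $R$, then $a$ can be chosen such that $\gcd(a,a_1,\dots,a_m)=1$, where $a_1,\dots,a_m$ are all the elements of $R$ occurring as a coefficient of some $h_i$.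
   Context: A function $h:R\to[0,\infty)$ is a height function of $\theta$-type if for all $x,y\in R$ and $n\in\mathbb N$ with $h(x)\le n$ and $h(y)\le n$ one has $h(x+y)\le\theta(n)$ and $h(xy)\le\theta(n)$. The function $h$ is extended to polynomials by $h\big(\sum_\alpha a_\alpha X^\alpha\big)=\max_\alpha h(a_\alpha)$. $\deg$ denotes total degree; $K^{alg}$ is an algebraic closure of $K$. An absolute value on $R$ is a map $|\cdot|:R\to[0,\infty)$ with $|x|=0$ iff $x=0$, $|xy|=|x||y|$, $|x+y|\le|x|+|y|$. $R$ is a UFD with the p-property if $R$ is a unique factorization domain endowed with an absolute value such that every unit has absolute value $1$, and such that whenever there are primes $p,q$ with $|p|<1<|q|$, there is another prime $r$ not associated to $p$ with $|r|<1$.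
   Formalization: The constant c_2 is allowed to depend also on h(-1), i.e. c_2=c_2(n,D,H,θ,h(-1)), because θ-type does not bound h(-x) and the claim with c_2(n,D,H,θ) alone fails (R=Z, h(x)=x for x≥0, M+|x| for x<0, f_1=X, f_2=X+1); for an absolute value h(-1)=1. *)

(* Defs.v *)
From HB Require Import structures.
From mathcomp Require Import all_boot all_order all_algebra.
From mathcomp Require Import fraction mpoly reals.

Set Implicit Arguments.
Unset Strict Implicit.
Unset Printing Implicit Defensive.

Import Order.TTheory GRing.Theory Num.Theory.

Local Open Scope ring_scope.

Section Heights.
Variables (RR : realType) (R : idomainType).

Definition height_of_type (theta : nat -> nat) (h : R -> RR) : Prop :=
  (forall x, 0 <= h x) /\
  (forall (x y : R) (n : nat), h x <= n%:R -> h y <= n%:R ->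
     h (x + y) <= (theta n)%:R /\ h (x * y) <= (theta n)%:R).

(* The maximum runs over the coefficients that actually occur in [p], so the
   zero polynomial has height 0 and [h 0] plays no role. *)
Definition poly_height (h : R -> RR) (n : nat) (p : {mpoly R[n]}) : RR :=
  \big[Num.max/0]_(m <- msupp p) h p@_m.

End Heights.

(* [msize p] is the total degree plus one, and 0 for [p = 0]; the zero
   polynomial thus gets degree 0 and satisfies every degree bound. *)
Definition total_degree (R : idomainType) (n : nat) (p : {mpoly R[n]}) : nat :=
  (msize p).-1.

(* [iota] presents the algebraically closed field [L] as an algebraic closure
   of the field of fractions of [R]. *)
Definition is_algebraic_closure (R : idomainType) (L : closedFieldType)
    (iota : {rmorphism {fraction R} -> L}) : Prop :=
  forall z : L, algebraicOver iota z.

Definition common_zero (R : idomainType) (L : closedFieldType)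
    (iota : {rmorphism {fraction R} -> L}) (n s : nat)
    (f : 'I_s -> {mpoly R[n]}) (z : 'I_n -> L) : Prop :=
  forall i, (map_mpoly (fun c : R => iota (tofrac c)) (f i)).@[z] = 0.

Section Divisibility.
Variable R : idomainType.

Definition divides (a b : R) : Prop := exists c, b = c * a.

Definition associated (a b : R) : Prop :=
  exists2 u : R, u \is a GRing.unit & b = u * a.

Definition irreducible_elt (p : R) : Prop :=
  [/\ p != 0, p \isn't a GRing.unit &
      forall a b, p = a * b -> a \is a GRing.unit \/ b \is a GRing.unit].

Definition prime_elt (p : R) : Prop :=
  [/\ p != 0, p \isn't a GRing.unit &
      forall a b, divides p (a * b) -> divides p a \/ divides p b].

Definition is_ufd : Prop :=
  (forall x : R, x != 0 -> x \isn't a GRing.unit ->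
     exists2 s : seq R, (forall p, p \in s -> irreducible_elt p) &
       x = \prod_(p <- s) p) /\
  (forall s t : seq R,
     (forall p, p \in s -> irreducible_elt p) ->
     (forall p, p \in t -> irreducible_elt p) ->
     \prod_(p <- s) p = \prod_(p <- t) p ->
     exists t' : seq R,
       [/\ perm_eq t t', size s = size t' &
           forall i, (i < size s)%N -> associated s`_i t'`_i]).

(* Greatest common divisors are only defined up to units: [is_gcd S 1] is the
   meaning of "the gcd of the elements of S is 1". *)
Definition is_gcd (S : R -> Prop) (d : R) : Prop :=
  (forall x, S x -> divides d x) /\
  (forall e, (forall x, S x -> divides e x) -> divides e d).

Variable RR : realType.

Definition is_absolute_value (v : R -> RR) : Prop :=
  [/\ forall x, 0 <= v x,
      forall x, v x = 0 <-> x = 0,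
      forall x y, v (x * y) = v x * v y &
      forall x y, v (x + y) <= v x + v y].

Definition ufd_with_p_property (v : R -> RR) : Prop :=
  [/\ is_ufd,
      is_absolute_value v,
      forall u, u \is a GRing.unit -> v u = 1 &
      forall p q, prime_elt p -> prime_elt q -> v p < 1 -> 1 < v q ->
        exists r, [/\ prime_elt r, ~ associated p r & v r < 1]].

End Divisibility.

(* Main.v *)
Require Import Defs.
From HB Require Import structures.
From mathcomp Require Import all_boot all_order all_algebra.
From mathcomp Require Import perm fraction mpoly boolp reals.
From mathcomp Require Import zify ring.

Set Implicit Arguments.
Unset Strict Implicit.
Unset Printing Implicit Defensive.

Import Order.TTheory GRing.Theory Num.Theory.

Local Open Scope ring_scope.

(* Over an algebraically closed field [L] a Nullstellensatz with a degree bound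
   is proved by induction on the number of variables, for arbitrary sets of
   polynomials of degree at most [d]. A Nagata change of variables makes one
   polynomial [f1] monic, up to a constant, in the main variable [T]. Given a
   point [x] of the smaller space, a linear combination [G] of the polynomials
   has no zero in common with [T f1] above [x]; the resultant of [T f1] and
   [G + T^(e+1) (T f1)] then lies in the ideal and does not vanish at [x]. All
   such resultants thus have no common zero and a bounded degree.

   The degree bound turns the identity [1 = sum f_i g_i] into a linear system
   over [R] which is solvable over [L], and Cramer's rule gives a solution over
   [R] whose entries are polynomials in the coefficients of the [f_i] of a form
   that depends only on [n] and [D]; this bounds their heights.

   For the last claim, divide by the gcd. This does not increase absolute
   values if all primes have absolute value at least 1, and the bound is trivial
   if none exceeds 1. Otherwise there are two non-associated primes [p] and [r]
   of absolute value less than 1; multiply the reduced solution by a power of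
   [p] and add a power of [r] times a primitive syzygy of two of the [f_i],
   shifted to large degree so that the two sets of coefficients do not mix. *)

(** * Degree filtrations *)

(** [F a x] stands for: x has degree at most a. One set of bounds on determinants and substitutions
    then serves both the total degree and the bidegree [bideg_le]. *)
Record is_filtration (A : comNzRingType) (F : nat -> A -> Prop) : Prop :=
  IsFiltration {
    fil_mono : forall a b x, (a <= b)%N -> F a x -> F b x;
    fil0 : forall a, F a 0;
    fil1 : F 0%N 1;
    filN : forall a x, F a x -> F a (- x);
    filD : forall a x y, F a x -> F a y -> F a (x + y);
    filM : forall a b x y, F a x -> F b y -> F (a + b)%N (x * y) }.

Section Filtration.
Variables (A : comNzRingType) (F : nat -> A -> Prop).
Hypothesis filF : is_filtration F.

Lemma fil_sum (I : Type) (r : seq I) (P : pred I) (E : I -> A) a :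
  (forall i, P i -> F a (E i)) -> F a (\sum_(i <- r | P i) E i).
Proof.
move=> FE; elim/big_ind: _ => //; first exact: (fil0 filF).
by move=> x y; apply: (filD filF).
Qed.

Lemma fil_prod (I : Type) (r : seq I) (P : pred I) (E : I -> A) (d : I -> nat) :
  (forall i, P i -> F (d i) (E i)) ->
  F (\sum_(i <- r | P i) d i)%N (\prod_(i <- r | P i) E i).
Proof.
move=> FE; elim/big_rec2: _ => [|i x a Pi Fx]; first exact: (fil1 filF).
by apply: (filM filF) => //; apply: FE.
Qed.

Lemma filX a x k : F a x -> F (a * k)%N (x ^+ k).
Proof.
move=> Fx; rewrite -[k]card_ord -prodr_const mulnC.
by rewrite -sum_nat_const; apply: fil_prod.
Qed.

Lemma fil_sign a k x : F a x -> F a ((-1) ^+ k * x).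
Proof.
by move=> Fx; rewrite -signr_odd mulr_sign; case: ifP => // _; apply: (filN filF).
Qed.

Lemma fil_det N (M : 'M[A]_N) a :
  (forall i j, F a (M i j)) -> F (N * a)%N (\det M).
Proof.
move=> FM; apply: fil_sum => s _.
apply: fil_sign.
have := @fil_prod _ (index_enum 'I_N) xpredT (fun i => M i (s i)) (fun=> a).
by rewrite sum_nat_const card_ord; apply=> i _.
Qed.

Lemma fil_cofactor N (M : 'M[A]_N) a i j :
  (forall i j, F a (M i j)) -> F (N * a)%N (cofactor M i j).
Proof.
move=> FM; apply: fil_sign.
have FM' : F (N.-1 * a)%N (\det (row' i (col' j M))).
  by apply: fil_det => k l; rewrite !mxE.
by apply: (fil_mono filF) FM'; rewrite leq_mul2r leq_pred orbT.
Qed.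

Lemma fil_mmap (R : nzRingType) n (c : R -> A) (g : 'I_n -> A) a d
    (p : {mpoly R[n]}) :
    (forall x, F 0%N (c x)) -> (forall i, F a (g i)) -> (msize p <= d.+1)%N ->
  F (a * d)%N (mmap c g p).
Proof.
move=> Fc Fg pd; rewrite /mmap big_seq; apply: fil_sum => m mp.
rewrite -[(a * d)%N]add0n; apply: (filM filF) => //.
have: F (\sum_(i < n) a * m i)%N (mmap1 g m).
  by apply: fil_prod => i _; apply: filX.
apply: (fil_mono filF); rewrite -big_distrr /= leq_mul2l -mdegE.
by rewrite -ltnS (leq_trans (msize_mdeg_lt mp) pd) orbT.
Qed.

End Filtration.

Lemma fil_msize (R : idomainType) n :
  is_filtration (fun d (p : {mpoly R[n]}) => (msize p <= d.+1)%N).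
Proof.
split=> [a b x ab|a||a x|a x y xa ya|a b x y xa yb].
- by move=> /leq_trans; apply; rewrite ltnS.
- by rewrite msize0.
- by rewrite msize1.
- by rewrite msizeN.
- by rewrite (leq_trans (msizeD_le _ _)) // geq_max xa.
have [->|nx] := eqVneq x 0; first by rewrite mul0r msize0.
have [->|ny] := eqVneq y 0; first by rewrite mulr0 msize0.
by rewrite msizeM //; lia.
Qed.

(** Both degrees, in the main variable and of the coefficients, share one bound so that
    [is_filtration] applies; the second half bounds the entries of Sylvester matrices. *)
Definition bideg_le (R : idomainType) n d (P : {poly {mpoly R[n]}}) : Prop :=
  (size P <= d.+1)%N /\ forall i, (msize P`_i <= d.+1)%N.

Lemma fil_bideg (R : idomainType) n : is_filtration (@bideg_le R n).
Proof.
have fm := fil_msize R n.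
split=> [a b x ab [x1 x2]|a||a x [x1 x2]|a x y [x1 x2] [y1 y2]|a b x y [x1 x2] [y1 y2]].
- split=> [|i]; first by apply: leq_trans x1 _.
  by apply: leq_trans (x2 i) _.
- by rewrite /bideg_le size_poly0; split => // i; rewrite coef0 msize0.
- rewrite /bideg_le size_poly1; split => // i; rewrite coef1.
  by case: eqP => _; rewrite ?msize1 ?msize0.
- by rewrite /bideg_le size_polyN; split=> // i; rewrite coefN msizeN.
- split=> [|i]; first by rewrite (leq_trans (size_polyD _ _)) // geq_max x1.
  by rewrite coefD; apply: (filD fm).
split=> [|i].
  by rewrite (leq_trans (size_polyMleq _ _)) //; lia.
by rewrite coefM; apply: (fil_sum fm) => j _; apply: (filM fm).
Qed.

Lemma bideg_polyC (R : idomainType) n d (p : {mpoly R[n]}) :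
  (msize p <= d.+1)%N -> bideg_le d p%:P.
Proof.
move=> pd; split=> [|i]; first by rewrite (leq_trans (size_polyC_leq1 _)).
by rewrite coefC; case: eqP; rewrite ?msize0.
Qed.

Lemma bideg_polyXn (R : idomainType) n d :
  @bideg_le R n d 'X^d.
Proof.
split=> [|i]; first by rewrite size_polyXn.
by rewrite coefXn; case: eqP; rewrite ?msize0 ?msize1.
Qed.

(** * Resultants: specialization and Bezout cofactors *)

Lemma map_resultant_lead (A B : nzRingType) (f : {rmorphism A -> B})
    (p q : {poly A}) :
    f (lead_coef p) != 0 -> f (lead_coef q) != 0 ->
  f (resultant p q) = resultant (map_poly f p) (map_poly f q).
Proof.
(* Nonzero images of the leading coefficients preserve both sizes, so the two Sylvester matrices
   have the same shape. *)
move=> nz_fp nz_fq; rewrite /resultant /Sylvester_mx !size_map_poly_id0 //.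
rewrite -det_map_mx /= map_col_mx; congr (\det (col_mx _ _));
  by apply: map_lin1_mx => v; rewrite map_poly_rV rmorphM /= map_rVpoly.
Qed.

(** Writing the Bezout multipliers with cofactors of the Sylvester matrix S makes the degrees of
    their coefficients computable. With [X] the column of powers of the variable, the product of S
    and [X] lists the shifts of p and q. Multiplying by the adjugate gives det S times [X], and the
    row of the power 0 is the identity. *)
Lemma resultant_cofactorE (A : comNzRingType) (p q : {poly A}) :
    (1 < size p)%N -> (1 < size q)%N ->
  exists j, (resultant p q)%:P =
    (\sum_(i < (size q).-1)
       (cofactor (Sylvester_mx p q) (lshift (size p).-1 i) j)%:P * 'X^i) * p +
    (\sum_(i < (size p).-1)
       (cofactor (Sylvester_mx p q) (rshift (size q).-1 i) j)%:P * 'X^i) * q.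
Proof.
move=> p_nc q_nc; set S := Sylvester_mx p q.
have dS_gt0: (0 < (size q).-1 + (size p).-1)%N by lia.
pose j0 := Ordinal dS_gt0; exists j0.
pose X : 'cV[{poly A}]_((size q).-1 + (size p).-1) := \col_j 'X^j.
have rowSX (r : {poly A}) (v : 'rV[A]_((size q).-1 + (size p).-1)) :
    (size r <= (size q).-1 + (size p).-1)%N -> v = poly_rV r ->
    \sum_j (v 0 j)%:P * 'X^j = r.
  move=> sr ->; rewrite -[RHS](poly_rV_K sr) /rVpoly poly_def.
  by apply: eq_bigr => j _; rewrite valK /= mul_polyC.
have SX : map_mx polyC S *m X = col_mx (\col_i ('X^i * p)) (\col_i ('X^i * q)).
  rewrite /S /Sylvester_mx map_col_mx mul_col_mx.
  congr col_mx; apply/colP => i; rewrite !mxE.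
    rewrite -(rowSX ('X^i * p) (row i (lin1_mx (poly_rV \o p \o* rVpoly)))).
    - by apply: eq_bigr => j _; rewrite !mxE.
    - rewrite (leq_trans (size_polyMleq _ _)) // size_polyXn addSn /=.
      by rewrite -{1}(ltn_predK p_nc) -addSnnS leq_add2r.
    - by rewrite rowE mul_rV_lin1 /= rVpoly_delta.
  rewrite -(rowSX ('X^i * q) (row i (lin1_mx (poly_rV \o q \o* rVpoly)))).
  - by apply: eq_bigr => j _; rewrite !mxE.
  - rewrite (leq_trans (size_polyMleq _ _)) // size_polyXn addSn /=.
    by rewrite -{1}(ltn_predK q_nc) -addSnnS addnC leq_add2l.
  - by rewrite rowE mul_rV_lin1 /= rVpoly_delta.
have: (map_mx polyC (\adj S) *m (map_mx polyC S *m X)) j0 0 = (\det S)%:P.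
  rewrite mulmxA -map_mxM mul_adj_mx map_scalar_mx mul_scalar_mx !mxE /=.
  by rewrite expr0 mulr1.
rewrite /resultant => <-; rewrite SX mxE big_split_ord /= !big_distrl /=.
by congr (_ + _); apply: eq_bigr => i _; rewrite ?col_mxEu ?col_mxEd !mxE mulrA.
Qed.

(** * Nagata change of variables *)

Lemma digits_inj n B (a b : 'I_n -> nat) :
    (forall i, (a i < B)%N) -> (forall i, (b i < B)%N) ->
    (\sum_(i < n) a i * B ^ i = \sum_(i < n) b i * B ^ i)%N ->
  a =1 b.
Proof.
elim: n a b => [|n IHn] a b aB bB; first by move=> _ [].
rewrite !big_ord_recl /= !expn0 !muln1.
have shift (c : 'I_n.+1 -> nat) :
    (\sum_(i < n) c (lift ord0 i) * B ^ (bump 0 i) =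
     (\sum_(i < n) c (lift ord0 i) * B ^ i) * B)%N.
  by rewrite big_distrl /=; apply: eq_bigr => i _; rewrite expnSr mulnA.
rewrite !shift => eq_ab.
have B_gt0 : (0 < B)%N by apply: leq_ltn_trans (aB ord0).
have ab0 : a ord0 = b ord0.
  have := congr1 (modn^~ B) eq_ab.
  by rewrite ![(_ + _ * B)%N]addnC !modnMDl !modn_small.
move: eq_ab; rewrite ab0 => /addnI/eqP; rewrite eqn_pmul2r // => /eqP eq_ab i.
case: (unliftP ord0 i) => [j ->|->] //.
by apply: (IHn (a \o lift ord0) (b \o lift ord0)) => //= k.
Qed.

Lemma rmorph_mmap n (R : nzRingType) (A B : comNzRingType)
    (tau : {rmorphism A -> B}) (c : R -> A) (g : 'I_n -> A) (p : {mpoly R[n]}) :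
  tau (mmap c g p) = mmap (tau \o c) (tau \o g) p.
Proof.
rewrite /mmap rmorph_sum; apply: eq_bigr => m _.
rewrite rmorphM rmorph_prod; congr (_ * _); apply: eq_bigr => i _.
by rewrite rmorphXn.
Qed.

Lemma eq_mmap n (R A : nzRingType) (c c' : R -> A) (g g' : 'I_n -> A)
    (p : {mpoly R[n]}) :
  c =1 c' -> g =1 g' -> mmap c g p = mmap c' g' p.
Proof.
move=> cc' gg'; apply: eq_bigr => m _; rewrite cc'; congr (_ * _).
exact: mmap1_eq.
Qed.

Lemma mmap_id n (R : comNzRingType) (p : {mpoly R[n]}) :
  mmap (@mpolyC n R) (fun i => 'X_i) p = p.
Proof.
rewrite {2}[p]mpolyE; apply: eq_bigr => m _.
by rewrite mmap1_id mul_mpolyC.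
Qed.

Section Nagata.
Variables (R : idomainType) (n B : nat).

(* [X_0] is sent to [T^(B^0) = T], and [X_(i+1)] to [X_i + T^(B^(i+1))]. *)
Definition nagata_var (k : 'I_n.+1) : {poly {mpoly R[n]}} :=
  (if unlift ord0 k is Some i then 'X_i else 0)%:P + 'X^(B ^ k).

Definition nagata (p : {mpoly R[n.+1]}) : {poly {mpoly R[n]}} :=
  mmap (polyC \o @mpolyC n R) nagata_var p.

HB.instance Definition _ := GRing.RMorphism.copy nagata
  (mmap (polyC \o @mpolyC n R) nagata_var).

(** The inverse change of variables on coefficients: where [nagata_var] adds a power of T, the same
    power of X_0 is subtracted; [unnagata] then sends T to X_0. *)
Definition unnagata0 (p : {mpoly R[n]}) : {mpoly R[n.+1]} :=
  mmap (@mpolyC n.+1 R)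
    (fun i => 'X_(lift ord0 i) - 'X_ord0 ^+ (B ^ i.+1)) p.

HB.instance Definition _ := GRing.RMorphism.copy unnagata0
  (mmap (@mpolyC n.+1 R)
    (fun i => 'X_(lift ord0 i) - 'X_ord0 ^+ (B ^ i.+1))).

Definition unnagata (P : {poly {mpoly R[n]}}) : {mpoly R[n.+1]} :=
  horner_eval 'X_ord0 (map_poly unnagata0 P).

HB.instance Definition _ := GRing.RMorphism.copy unnagata
  (horner_eval ('X_ord0 : {mpoly R[n.+1]}) \o map_poly unnagata0).

Lemma unnagataC p : unnagata p%:P = unnagata0 p.
Proof. by rewrite /unnagata map_polyC /horner_eval hornerC. Qed.

Lemma unnagataX : unnagata 'X = 'X_ord0.
Proof. by rewrite /unnagata map_polyX /horner_eval hornerX. Qed.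

Lemma nagataK : cancel nagata unnagata.
Proof.
move=> p; rewrite /nagata rmorph_mmap -[RHS]mmap_id; apply: eq_mmap => [c|k] /=.
  by rewrite unnagataC /unnagata0 mmapC.
rewrite /nagata_var rmorphD rmorphXn /= unnagataX unnagataC.
case: unliftP => [i ->|->]; last by rewrite rmorph0 add0r expn0 expr1.
by rewrite /unnagata0 mmapX mmap1U subrK.
Qed.

(** A pair (x, t) in the new coordinates is a point of the old space, so polynomials without common
    zero keep this property after the change of variables. *)
Lemma horner_nagata (x : 'I_n -> R) t (p : {mpoly R[n.+1]}) :
  (map_poly (meval x) (nagata p)).[t] =
  p.@[fun k => (if unlift ord0 k is Some i then x i else 0) + t ^+ (B ^ k)].
Proof.
rewrite -/(horner_eval t _) -/((horner_eval t \o map_poly (meval x)) _).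
rewrite rmorph_mmap; apply: eq_mmap => [c|k] /=.
  by rewrite map_polyC /= mevalC /horner_eval hornerC.
rewrite /nagata_var rmorphD rmorphXn /= map_polyX map_polyC /horner_eval !hornerE /=.
by case: unlift => [i|]; rewrite ?mevalXU ?meval0.
Qed.

Hypothesis B_gt0 : (0 < B)%N.

Lemma bideg_nagata d p : (msize p <= d.+1)%N -> bideg_le (B ^ n * d) (nagata p).
Proof.
have fb := fil_bideg R n.
apply: (fil_mmap fb) => [c|k] /=.
  by apply: bideg_polyC; rewrite msizeC; case: eqP.
apply: (filD fb).
  apply: bideg_polyC; case: unlift => [i|]; last by rewrite msize0.
  by rewrite msizeX mdeg1 ltnS expn_gt0 B_gt0.
apply: (fil_mono fb) (bideg_polyXn _ _ _).
by rewrite leq_pexp2l // -ltnS.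
Qed.

Lemma msize_unnagata0 d p :
  (msize p <= d.+1)%N -> (msize (unnagata0 p) <= (B ^ n * d).+1)%N.
Proof.
have fm := fil_msize R n.+1.
apply: (fil_mmap fm) => [c|i] /=.
  by rewrite msizeC; case: eqP.
apply: (filD fm); first by rewrite msizeX mdeg1 ltnS expn_gt0 B_gt0.
apply: (filN fm); rewrite mpolyXn msizeX ltnS mdegMn mdeg1 mul1n.
by rewrite leq_pexp2l.
Qed.

Lemma nagata_mmap1 (m : 'X_{1..n.+1}) :
  mmap1 nagata_var m \is monic /\
  size (mmap1 nagata_var m) = (\sum_(i < n.+1) m i * B ^ i).+1.
Proof.
have size_var k : size (nagata_var k) = (B ^ k).+1.
  rewrite /nagata_var addrC size_polyDl size_polyXn //.
  by rewrite (leq_ltn_trans (size_polyC_leq1 _)) // ltnS expn_gt0 B_gt0.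
have mon_var k : nagata_var k \is monic.
  rewrite monicE /nagata_var lead_coefDr ?lead_coefXn // size_polyXn.
  by rewrite (leq_ltn_trans (size_polyC_leq1 _)) // ltnS expn_gt0 B_gt0.
have sizeX k : size (nagata_var k ^+ m k) = (m k * B ^ k).+1.
  elim: (m k) => [|j IHj]; first by rewrite expr0 size_poly1.
  rewrite exprS size_monicM ?monic_exp ?mon_var -?size_poly_eq0 ?IHj //.
  by rewrite size_var mulSn addnS.
rewrite /mmap1; elim/big_rec2: _ => [|k w P _ [IHm IH]].
  by rewrite size_poly1 monic1.
rewrite size_monicM ?monic_exp // -?size_poly_eq0 ?IH // sizeX addnS addSn /=.
by split=> //; rewrite monicMl // monic_exp.
Qed.

(* Base-[B] expansions are unique, so the images of the monomials of [p] have
   pairwise distinct degrees in [T]. *)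
Lemma lead_coef_nagata p : (msize p <= B)%N -> p != 0 ->
  exists2 c : R, c != 0 & lead_coef (nagata p) = c%:MP.
Proof.
move=> pB p0; pose wt (m : 'X_{1..n.+1}) := (\sum_(i < n.+1) m i * B ^ i)%N.
have wt_inj : {in msupp p &, injective wt}.
  have ltB (m : 'X_{1..n.+1}) : m \in msupp p -> forall i, (m i < B)%N.
    move=> /msize_mdeg_lt mp i; apply: leq_trans pB; apply: leq_ltn_trans mp.
    by rewrite mdegE (bigD1 i) //= leq_addr.
  by move=> m m' mp m'p /digits_inj E; apply/mnmP => i; apply: E; apply: ltB.
have [m mp max_m] : exists2 m, m \in msupp p &
    forall m', m' \in msupp p -> m' != m -> (wt m' < wt m)%N.
  case E: (msupp p) => [|m0 s]; first by move: p0; rewrite -msupp_eq0 E.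
  have sz : (0 < size (msupp p))%N by rewrite E.
  have [i _ max_i] := @arg_maxnP _ (Ordinal sz) xpredT
     (fun i => wt (nth 0%MM (msupp p) i)) isT.
  exists (nth 0%MM (msupp p) i); first by rewrite -E mem_nth.
  move=> m'; rewrite -E => m'p nm'.
  have im' : (index m' (msupp p) < size (msupp p))%N by rewrite index_mem.
  have := max_i (Ordinal im') isT; rewrite /= nth_index // leq_eqVlt.
  case/orP => // /eqP/wt_inj eqm; move: nm'; rewrite eqm ?eqxx //.
  by rewrite mem_nth.
exists p@_m; first by rewrite -mcoeff_msupp.
have naE : nagata p = (p@_m)%:MP%:P * mmap1 nagata_var m +
    \sum_(m' <- rem m (msupp p)) (p@_m')%:MP%:P * mmap1 nagata_var m'.
  by rewrite /nagata /mmap (perm_big _ (perm_to_rem mp)) /= big_cons.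
have [mon_m sz_m] := nagata_mmap1 m.
have c0 : (p@_m)%:MP_[n] != 0 by rewrite mpolyC_eq0 -mcoeff_msupp.
rewrite naE lead_coefDl ?lead_coef_Mmonic ?lead_coefC //.
rewrite size_Mmonic ?polyC_eq0 // size_polyC c0 /= sz_m ltnS.
apply: leq_trans (size_sum _ _ _) _; apply/bigmax_leqP_seq => m'.
rewrite mem_rem_uniq ?msupp_uniq // inE => /andP[nm' m'p] _.
have [mon_m' sz_m'] := nagata_mmap1 m'.
have c0' : (p@_m')%:MP_[n] != 0 by rewrite mpolyC_eq0 -mcoeff_msupp.
rewrite size_Mmonic ?polyC_eq0 // size_polyC c0' /= sz_m'.
exact: max_m.
Qed.

End Nagata.

(** * Nullstellensatz with a degree bound *)

(** Only the degrees of the multipliers are bounded, not the number of terms, since the sets [S] met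
    in the induction may be infinite. *)
Inductive bounded_ideal (R : idomainType) n (S : {mpoly R[n]} -> Prop) (d : nat) :
    {mpoly R[n]} -> Prop :=
| BoundedIdeal0 : bounded_ideal S d 0
| BoundedIdealS f g p : S f -> (msize g <= d.+1)%N -> bounded_ideal S d p ->
    bounded_ideal S d (f * g + p).

Section BoundedIdeal.
Variables (R : idomainType) (n : nat) (S : {mpoly R[n]} -> Prop).

Lemma bounded_ideal_mem d f g : S f -> (msize g <= d.+1)%N ->
  bounded_ideal S d (f * g).
Proof.
move=> Sf gd; rewrite -[f * g]addr0.
by apply: BoundedIdealS => //; apply: BoundedIdeal0.
Qed.

Lemma bounded_idealD d p q :
  bounded_ideal S d p -> bounded_ideal S d q -> bounded_ideal S d (p + q).
Proof.
move=> Ip Iq; elim: Ip => [|f g p' Sf gd _ IH]; first by rewrite add0r.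
by rewrite -addrA; constructor.
Qed.

Lemma bounded_ideal_sum d (I : Type) (r : seq I) (E : I -> {mpoly R[n]}) :
  (forall i, bounded_ideal S d (E i)) -> bounded_ideal S d (\sum_(i <- r) E i).
Proof.
move=> IE; elim/big_ind: _ => //; first exact: BoundedIdeal0.
exact: bounded_idealD.
Qed.

Lemma bounded_idealM d e p q : bounded_ideal S d p -> (msize q <= e.+1)%N ->
  bounded_ideal S (e + d)%N (q * p).
Proof.
move=> Ip qe; elim: Ip => [|f g p' Sf gd _ IH].
  by rewrite mulr0; constructor.
rewrite mulrDr mulrCA; constructor => //.
exact: (filM (fil_msize R n)).
Qed.

End BoundedIdeal.

(* [(d + 1)^n * d] bounds the bidegrees after the change of variables, the
   Sylvester matrix has size at most [3 e + 3] and entries of degree at most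
   [2 e + 2]. *)
Fixpoint nullstellensatz_degree (n d : nat) : nat :=
  if n is n'.+1 then
    let W := (d.+1 ^ n')%N in
    let e := (W * d)%N in
    let N := (3 * e + 3)%N in
    let b := (N * (2 * e + 2))%N in
    (W * nullstellensatz_degree n' b + (W * b + N + e + 2))%N
  else 0.

Section ClosedField.
Variable L : closedFieldType.

Lemma closed_poly_roots (p : {poly L}) : p != 0 ->
  exists rs : seq L, forall t, root p t -> t \in rs.
Proof.
move=> p0; have [rs pE] := closed_field_poly_normal p; exists rs => t.
by rewrite pE rootZ ?lead_coef_eq0 // root_prod_XsubC.
Qed.

(** For each element of [rs] pick an [f i] whose polynomial does not vanish there. The weights are
    the powers of one scalar: at a given t the combination is a polynomial in this scalar, nonzero
    because its coefficient at the index of t is. A non-root of the product of these polynomials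
    works for all t at once. *)
Lemma avoid_roots (T : Type) (S : T -> Prop) (q : T -> {poly L}) (rs : seq L) :
    (forall t, exists2 f, S f & (q f).[t] != 0) ->
  exists (k : nat) (f : 'I_k -> T) (lam : 'I_k -> L), (forall i, S (f i)) /\
    forall t, t \in rs -> (\sum_i lam i *: q (f i)).[t] != 0.
Proof.
move=> Sq.
have [f Sf] : exists f : 'I_(size rs) -> T,
    forall i : 'I_(size rs), S (f i) /\ (q (f i)).[rs`_i] != 0.
  elim: rs => [|t rs [f IH]].
    by have [g _ _] := Sq 0; exists (fun=> g) => -[].
  have [g Sg tg] := Sq t.
  exists (fun i => if unlift ord0 i is Some j then f j else g) => i.
  by case: unliftP => [j ->|->] //=; apply: IH.
pose P (t : L) : {poly L} :=
  \poly_(i < size rs) (if insub i is Some j then (q (f j)).[t] else 0).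
have PE t i : (P t)`_i = if insub i is Some j then (q (f j)).[t] else 0.
  by rewrite coef_poly; case: insubP => [j -> //|/negPf->].
have : \prod_(t <- rs) P t != 0.
  rewrite prodf_seq_neq0; apply/allP => t trs; apply/implyP => _.
  have it : (index t rs < size rs)%N by rewrite index_mem.
  apply/eqP => /(congr1 (fun p : {poly L} => p`_(index t rs))).
  rewrite coef0 PE; case: insubP => [j _ /= ji|/negP//]; apply/eqP.
  by have [_] := Sf j; rewrite ji nth_index.
case/closed_nonrootP => lam; rewrite /root horner_prod prodf_seq_neq0 => /allP lamP.
exists (size rs), f, (fun i => lam ^+ i); split=> [i|t trs]; first by case: (Sf i).
have /= := lamP t trs; rewrite (horner_coef_wide _ (size_poly _ _)) horner_sum.
congr (_ != 0); apply: eq_bigr => i _.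
by rewrite hornerZ mulrC PE valK.
Qed.

Section Step.
Variables (n d : nat).
Let B := d.+1.
Let W := (B ^ n)%N.
Let e := (W * d)%N.
Let N := (3 * e + 3)%N.
Let b := (N * (2 * e + 2))%N.
Variable S : {mpoly L[n.+1]} -> Prop.
Hypothesis Sd : forall f, S f -> (msize f <= d.+1)%N.
Hypothesis S_nz : forall x : 'I_n.+1 -> L, exists2 f, S f & f.@[x] != 0.

Local Notation nag := (@nagata L n B).
Local Notation unnag := (@unnagata L n B).

Lemma eliminant (x : 'I_n -> L) :
  exists p : {mpoly L[n]}, [/\ (msize p <= b.+1)%N, p.@[x] != 0 &
    bounded_ideal S (W * b + N + e + 2) (unnag p%:P)].
Proof.
have fb := fil_bideg L n; have fm := fil_msize L n; have fm' := fil_msize L n.+1.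
have [f1 Sf1 f1x] := S_nz (fun=> 0).
have f1_nz : f1 != 0 by apply: contraNneq f1x => ->; rewrite meval0.
have [c1 c1_nz lead_f1] := lead_coef_nagata (ltn0Sn d) (Sd Sf1) f1_nz.
(* The factor ['X] gives [F1] positive degree even if [f1] is a constant, as [resultant_cofactorE]
   requires. *)
pose F1 : {poly {mpoly L[n]}} := 'X * nag f1.
have nagf1_nz : nag f1 != 0 by rewrite -lead_coef_eq0 lead_f1 mpolyC_eq0.
have lead_F1 : lead_coef F1 = c1%:MP by rewrite lead_coefM lead_coefX mul1r.
have size_F1 : size F1 = (size (nag f1)).+1 by rewrite /F1 mulrC size_mulX.
have bd_nag f : S f -> bideg_le e (nag f).
  by move=> /Sd fd; apply: bideg_nagata.
have bd_F1 : bideg_le e.+1 F1.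
  by apply: (filM fb (a := 1)) (bd_nag _ Sf1); apply: (bideg_polyXn _ _ 1).
pose ev := map_poly (meval x).
have ev_lead (P : {poly {mpoly L[n]}}) (c : L) : c != 0 -> lead_coef P = c%:MP ->
   meval x (lead_coef P) != 0.
  by move=> c0 ->; rewrite mevalC.
have evF1 : ev F1 != 0.
  by rewrite map_poly_eq0_id0 ?(ev_lead _ c1) // -lead_coef_eq0 lead_F1 mpolyC_eq0.
have [rs rsP] := closed_poly_roots evF1.
have [k [f [lam [Sf lam_nz]]]] : exists (k : nat) (f : 'I_k -> {mpoly L[n.+1]})
    (lam : 'I_k -> L), (forall i, S (f i)) /\
    forall t, t \in rs -> (\sum_i lam i *: ev (nag (f i))).[t] != 0.
  apply: (avoid_roots (q := fun f => ev (nag f))) => t.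
  have [f Sf ft] := S_nz (fun k =>
    (if unlift ord0 k is Some i then x i else 0) + t ^+ (B ^ k)).
  by exists f => //; rewrite horner_nagata.
pose G : {mpoly L[n.+1]} := \sum_i lam i *: f i.
have nagZ c g : nag (c *: g) = c%:MP%:P * nag g.
  by rewrite -mul_mpolyC rmorphM /= {1}/nagata mmapC.
have evG : ev (nag G) = \sum_i lam i *: ev (nag (f i)).
  rewrite (rmorph_sum (@nagata L n B)) /ev (rmorph_sum (map_poly (meval x))).
  apply: eq_bigr => i _ /=.
  by rewrite nagZ rmorphM /= map_polyC /= mevalC mul_polyC.
have bd_G : bideg_le e (nag G).
  apply: bideg_nagata => //; apply: (fil_sum fm') => i _.
  by apply: leq_trans (msizeZ_le _ _) _; apply: Sd.
(* Adding a multiple of [F1] does not change the common zeros with [F1]. The added term dominates in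
   degree and gives [F2] the constant leading coefficient [c1], which survives evaluation at [x]. *)
pose F2 : {poly {mpoly L[n]}} := nag G + 'X^(e.+1) * F1.
have bd_F2 : bideg_le (2 * e + 2) F2.
  apply: (filD fb); first by apply: (fil_mono fb) bd_G; lia.
  have -> : (2 * e + 2 = e.+1 + e.+1)%N by lia.
  by apply: (filM fb) => //; apply: bideg_polyXn.
have F1_nz : F1 != 0 by rewrite -lead_coef_eq0 lead_F1 mpolyC_eq0.
have size_XF1 : size ('X^(e.+1) * F1) = (e.+1 + size F1)%N.
  by rewrite mulrC size_mulXn // addnC.
have sizeG : (size (nag G) < size ('X^(e.+1) * F1)%R)%N.
  by rewrite size_XF1; case: bd_G => [sG _]; rewrite size_F1; lia.
have lead_F2 : lead_coef F2 = c1%:MP.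
  by rewrite lead_coefDr // lead_coefM lead_coefXn mul1r.
have size_F2 : size F2 = (e.+1 + size F1)%N by rewrite /F2 addrC size_polyDl.
have F1_gt1 : (1 < size F1)%N by rewrite size_F1 ltnS size_poly_gt0.
have F2_gt1 : (1 < size F2)%N by rewrite size_F2; lia.
have S_le i j : (msize (Sylvester_mx F1 F2 i j) <= (2 * e + 2).+1)%N.
  have coefF (r : {poly {mpoly L[n]}}) l (le : bool) : bideg_le (2 * e + 2) r ->
      (msize (r`_l *+ le)%R <= (2 * e + 2).+1)%N.
    by case: le => -[_ rl]; rewrite ?mulr1n ?mulr0n ?msize0.
  rewrite Sylvester_mxE; case: splitP => l _; apply: coefF => //.
  by apply: (fil_mono fb) bd_F1; lia.
have N_le : ((size F2).-1 + (size F1).-1 <= N)%N.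
  by rewrite size_F2; case: bd_F1 => + _; rewrite /N; move: (size F1) => z; lia.
have cof_le i j : (msize (cofactor (Sylvester_mx F1 F2) i j) <= b.+1)%N.
  apply: leq_trans (fil_cofactor fm _ _ S_le) _.
  by rewrite ltnS leq_mul2r N_le orbT.
exists (resultant F1 F2); split.
- apply: leq_trans (fil_det fm S_le) _.
  by rewrite ltnS leq_mul2r N_le orbT.
- rewrite (map_resultant_lead (f := meval x)) ?(ev_lead _ c1) //.
  (* A vanishing resultant would give a common root t; there [F2] equals [nag G], which was built
     not to vanish at the roots of [F1]. *)
  rewrite resultant_eq0 -leqNgt leqNgt; apply/negP => gcd_gt1.
  have /closed_rootP[t] : size (gcdp (ev F1) (ev F2)) != 1 by rewrite gtn_eqF.
  rewrite root_gcd => /andP[F1t F2t].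
  have := lam_nz t (rsP t F1t); rewrite -evG.
  move: F2t; rewrite /root /F2 /ev rmorphD rmorphM hornerD hornerM.
  by rewrite -/ev (rootP F1t) mulr0 addr0 => ->.
have [j ->] := resultant_cofactorE F1_gt1 F2_gt1.
have unnag_le l (s : 'I_l -> 'I_((size F2).-1 + (size F1).-1)) : (l <= N)%N ->
  (msize (unnag (\sum_(i < l) (cofactor (Sylvester_mx F1 F2) (s i) j)%:P * 'X^i))
     <= (W * b + N).+1)%N.
  move=> lN; rewrite rmorph_sum; apply: (fil_sum fm') => i _ /=.
  rewrite rmorphM rmorphXn /= unnagataX unnagataC; apply: (filM fm').
    exact: msize_unnagata0.
  rewrite mpolyXn msizeX ltnS mdegMn mdeg1 mul1n.
  exact: leq_trans (ltnW (ltn_ord i)) lN.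
rewrite rmorphD /= [unnag (_ * F1)]rmorphM [unnag (_ * F2)]rmorphM /=.
set U := (X in X * unnag F1); set V := (X in X * unnag F2).
have U_le : (msize U <= (W * b + N).+1)%N.
  by apply: unnag_le; apply: leq_trans N_le; apply: leq_addr.
have V_le : (msize V <= (W * b + N).+1)%N.
  by apply: unnag_le; apply: leq_trans N_le; apply: leq_addl.
have uF1 : unnag F1 = f1 * 'X_ord0.
  by rewrite /F1 rmorphM /= unnagataX nagataK mulrC.
(* Back in the original variables both polynomials are combinations of elements of [S]; the power
   [e.+2] accounts for the last summands e + 2 of the degree. *)
have -> : unnag F2 = G + f1 * 'X_ord0 ^+ e.+2.
  rewrite /F2 rmorphD rmorphM rmorphXn /= unnagataX nagataK uF1.
  by rewrite mulrCA -exprSr.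
have X_le l : (msize ('X_ord0 ^+ l : {mpoly L[n.+1]}) <= l.+1)%N.
  by rewrite mpolyXn msizeX ltnS mdegMn mdeg1 mul1n.
have -> : (W * b + N + e + 2 = W * b + N + (e + 2))%N by lia.
rewrite uF1 mulrDr addrCA; apply: bounded_idealD.
  rewrite /G big_distrr /=; apply: bounded_ideal_sum => i.
  rewrite -mul_mpolyC mulrCA [V * _]mulrC mulrCA; apply: bounded_ideal_mem => //.
  rewrite mul_mpolyC; apply: leq_trans (msizeZ_le _ _) _.
  by apply: leq_trans V_le _; lia.
apply: bounded_idealD; apply: bounded_idealM => //.
  by apply: bounded_ideal_mem => //; apply: leq_trans (X_le 1) _; lia.
by apply: bounded_ideal_mem => //; apply: leq_trans (X_le _) _; lia.
Qed.

(** The hypothesis is applied to all polynomials in [n] variables of degree at most [b] whose image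
    under [unnag] lies in the ideal with multiplier degree [b']; by [eliminant] they have no common
    zero. Undoing the change of variables multiplies the degree [c] of the new multipliers by
    [W]. *)
Lemma nullstellensatz_step c :
    (forall S' : {mpoly L[n]} -> Prop, (forall f, S' f -> (msize f <= b.+1)%N) ->
       (forall x, exists2 f, S' f & f.@[x] != 0) -> bounded_ideal S' c 1) ->
  bounded_ideal S (W * c + (W * b + N + e + 2)) 1.
Proof.
pose b' := (W * b + N + e + 2)%N; move=> IH.
pose S' (p : {mpoly L[n]}) := (msize p <= b.+1)%N /\
  bounded_ideal S b' (unnag p%:P).
have : bounded_ideal S' c 1.
  apply: IH => [f []|x] //.
  by have [p [pb px Ip]] := eliminant x; exists p.
suff lift_ideal p : bounded_ideal S' c p ->
    bounded_ideal S (W * c + b') (unnag p%:P).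
  by move/lift_ideal; rewrite polyC1 rmorph1.
elim=> [|f g p' [_ Sf] gc _ IHp]; first by rewrite polyC0 rmorph0; constructor.
rewrite polyCD polyCM rmorphD rmorphM; apply: bounded_idealD => //.
rewrite /= mulrC; apply: (@bounded_idealM _ _ _ b' (W * c)%N); first exact: Sf.
by rewrite unnagataC; apply: msize_unnagata0.
Qed.

End Step.

Theorem effective_nullstellensatz n d (S : {mpoly L[n]} -> Prop) :
    (forall f, S f -> (msize f <= d.+1)%N) ->
    (forall x, exists2 f, S f & f.@[x] != 0) ->
  bounded_ideal S (nullstellensatz_degree n d) 1.
Proof.
elim: n d S => [|n IHn] d S Sd S_nz; last first.
  by apply: nullstellensatz_step => // S'; apply: IHn.
have [f Sf] := S_nz (fun=> 0); have [c fE] : exists c, f = c%:MP.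
  exists f@_0%MM; apply/mpolyP => m; rewrite mcoeffC.
  by have -> : m = 0%MM; [apply/mnmP => -[] | rewrite eqxx mulr1].
rewrite fE mevalC => c0.
have -> : 1 = f * (c^-1)%:MP by rewrite fE -mpolyCM divff // mpolyC1.
by apply: bounded_ideal_mem => //; rewrite msizeC; case: eqP.
Qed.

End ClosedField.

(** * Heights and Cramer's rule *)

Lemma size_index_enum (T : finType) : size (index_enum T) = #|T|.
Proof.
by rewrite cardT enumT [index_enum T]unlock.
Qed.

(** Bounds the height after k nested additions or multiplications starting from height at most b.
    The maximum makes it monotone in k for any [theta]. *)
Fixpoint height_bound (theta : nat -> nat) (b k : nat) : nat :=
  if k is k'.+1 then
    maxn (height_bound theta b k') (theta (height_bound theta b k'))
  else b.

Lemma leq_height_bound theta b : {homo height_bound theta b : j k / (j <= k)%N}.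
Proof.
by apply: homo_leq => [//|j k l|k] /=; [apply: leq_trans | apply: leq_maxl].
Qed.

Section HeightLevels.
Variables (RR : realType) (R : idomainType) (theta : nat -> nat) (h : R -> RR).
Hypothesis h_type : height_of_type theta h.
Variable b : nat.
Hypothesis hN1 : h (-1) <= b%:R.

Definition height_level k x := h x <= (height_bound theta b k)%:R.

Lemma height_level_mono j k x :
  (j <= k)%N -> height_level j x -> height_level k x.
Proof.
by move=> jk /le_trans; apply; rewrite ler_nat leq_height_bound.
Qed.

Lemma height_levelD k x y :
  height_level k x -> height_level k y -> height_level k.+1 (x + y).
Proof.
move=> hx hy; have [+ _] := h_type.2 _ _ _ hx hy.
by move/le_trans; apply; rewrite ler_nat leq_maxr.
Qed.

Lemma height_levelM k x y :
  height_level k x -> height_level k y -> height_level k.+1 (x * y).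
Proof.
move=> hx hy; have [_ +] := h_type.2 _ _ _ hx hy.
by move/le_trans; apply; rewrite ler_nat leq_maxr.
Qed.

(** The bound is given for [h (-1)], so 1 is reached as (-1)(-1), one level up, and 0 as 1 + (-1),
    at level 2. Hence the condition 2 <= k in the lemmas below. *)
Lemma height_level1 : height_level 1 1.
Proof. by rewrite -[1]mul1r -mulrNN; apply: height_levelM. Qed.

Lemma height_level0 : height_level 2 0.
Proof.
rewrite -(subrr 1); apply: height_levelD; first exact: height_level1.
exact: (height_level_mono (j := 0)).
Qed.

Lemma height_level_natb k (c : bool) : (2 <= k)%N -> height_level k c%:R.
Proof.
move=> k2; apply: height_level_mono k2 _; case: c; last exact: height_level0.
exact: height_level_mono height_level1.
Qed.

Lemma height_level_sign k j : (2 <= k)%N -> height_level k ((-1) ^+ j).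
Proof.
move=> k2; apply: height_level_mono k2 _; rewrite -signr_odd; case: odd.
  by rewrite expr1; apply: (height_level_mono (j := 0)).
exact: height_level_mono height_level1.
Qed.

Lemma height_level_sum (I : Type) (r : seq I) (E : I -> R) k : (2 <= k)%N ->
  (forall i, height_level k (E i)) ->
  height_level (k + size r) (\sum_(i <- r) E i).
Proof.
move=> k2 hE; elim: r => [|i r IHr].
  by rewrite big_nil addn0; apply: (height_level_natb false).
rewrite big_cons /= addnS; apply: height_levelD => //.
by apply: height_level_mono (hE i); apply: leq_addr.
Qed.

Lemma height_level_sum_ord r (E : 'I_r -> R) k : (2 <= k)%N ->
  (forall i, height_level k (E i)) -> height_level (k + r) (\sum_i E i).
Proof.
by move=> k2 /(height_level_sum (index_enum 'I_r) k2); rewrite size_index_enum card_ord.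
Qed.

Lemma height_level_prod (I : Type) (r : seq I) (E : I -> R) k : (2 <= k)%N ->
  (forall i, height_level k (E i)) ->
  height_level (k + size r) (\prod_(i <- r) E i).
Proof.
move=> k2 hE; elim: r => [|i r IHr].
  by rewrite big_nil addn0; apply: (height_level_natb true).
rewrite big_cons /= addnS; apply: height_levelM => //.
by apply: height_level_mono (hE i); apply: leq_addr.
Qed.

(** In the Leibniz formula the N factors, the sign and the N! summands each cost one level. *)
Lemma height_level_det N (A : 'M[R]_N) k : (2 <= k)%N ->
  (forall i j, height_level k (A i j)) ->
  height_level (k + N + 1 + N`!) (\det A).
Proof.
move=> k2 hA; rewrite -[X in (_ + X)%N]card_Sn -size_index_enum.
apply: height_level_sum => [|s]; first lia.
rewrite addn1; apply: height_levelM; first by apply: height_level_sign; lia.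
rewrite -[X in (_ + X)%N](card_ord N) -size_index_enum.
exact: height_level_prod.
Qed.

Lemma height_level_cofactor N (A : 'M[R]_N) k i j : (2 <= k)%N ->
  (forall i j, height_level k (A i j)) ->
  height_level (k + N + 2 + N`!) (cofactor A i j).
Proof.
move=> k2 hA.
have -> : (k + N + 2 + N`! = (k + N + 1 + N`!).+1)%N by lia.
apply: height_levelM; first by apply: height_level_sign; lia.
have hA' : height_level (k + N.-1 + 1 + N.-1`!) (\det (row' i (col' j A))).
  by apply: height_level_det => // i' j'; rewrite !mxE.
apply: height_level_mono hA'; case: (N) => [|N'] //.
have : (N'`! <= N'.+1`!)%N by rewrite factS leq_pmull.
by rewrite /=; lia.
Qed.

End HeightLevels.

(** * Cramer's rule over the domain *)

Section Cramer.
Variables (R : idomainType) (L : fieldType) (phi : {rmorphism R -> L}).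
Hypothesis phi_inj : injective phi.

(** Over the field, choose a maximal independent set of rows, then columns on which they form an
    invertible matrix. Those columns determine the solution; the adjugate clears denominators, and
    injectivity of [phi] brings the identity back to [R]. The bound on [r] is by the number of
    columns, which in the application does not depend on the number of polynomials. *)
Lemma cramer_minor m k (A : 'M[R]_(m, k)) (u : 'rV[R]_k) :
    (map_mx phi u <= map_mx phi A)%MS ->
  exists r (f : 'I_r -> 'I_m) (g : 'I_r -> 'I_k), [/\ (r <= k)%N,
    \det (mxsub f g A) != 0 &
    colsub g u *m \adj (mxsub f g A) *m rowsub f A = \det (mxsub f g A) *: u].
Proof.
move=> uA; pose AL := map_mx phi A; pose f := maxrankfun AL.
have fullT : row_full (rowsub f AL)^T.
  by rewrite /row_full mxrank_tr; apply: maxrowsub_free.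
pose g := fullrankfun fullT.
exists (\rank AL), f, g.
have BL : map_mx phi (mxsub f g A) = (rowsub g (rowsub f AL)^T)^T.
  by apply/matrixP => i j; rewrite !mxE.
have detB : phi (\det (mxsub f g A)) != 0.
  by rewrite -det_map_mx BL det_tr -unitfE -unitmxE fullrowsub_unit.
split; first exact: rank_leq_col.
  by apply: contraNneq detB => ->; rewrite rmorph0.
have [w uw] : exists w, map_mx phi u = w *m rowsub f AL.
  by apply/submxP; rewrite eq_maxrowsub.
suff eq_phi : map_mx phi (colsub g u *m \adj (mxsub f g A) *m rowsub f A) =
    map_mx phi (\det (mxsub f g A) *: u).
  apply/matrixP => i j; apply: phi_inj.
  by have /matrixP/(_ i j) := eq_phi; rewrite [LHS]mxE [RHS]mxE.
rewrite !map_mxM map_mxZ uw map_mx_adj.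
have -> : map_mx phi (colsub g u) = w *m map_mx phi (mxsub f g A).
  rewrite map_mxsub uw -mulmx_colsub; congr (_ *m _).
  by apply/matrixP => i j; rewrite !mxE.
rewrite -[w *m _ *m _]mulmxA mul_mx_adj mul_mx_scalar det_map_mx -scalemxAl.
by rewrite map_mxsub.
Qed.

End Cramer.

Lemma nullstellensatz_family (L : closedFieldType) n d s
    (f : 'I_s -> {mpoly L[n]}) :
    (forall i, (msize (f i) <= d.+1)%N) ->
    (forall x, exists i, (f i).@[x] != 0) ->
  exists g : 'I_s -> {mpoly L[n]}, \sum_i f i * g i = 1 /\
    forall i, (msize (g i) <= (nullstellensatz_degree n d).+1)%N.
Proof.
move=> fd f_nz; pose S p := exists i, p = f i.
have : bounded_ideal S (nullstellensatz_degree n d) 1.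
  apply: effective_nullstellensatz => [p [i ->] //|x].
  by have [i fi] := f_nz x; exists (f i) => //; exists i.
move: (1 : {mpoly L[n]}) => p; elim=> [|_ q p' [i ->] qc _ [g [gE gc]]].
  exists (fun=> 0); split=> [|i]; last by rewrite msize0.
  by rewrite big1 // => i _; rewrite mulr0.
have fm := fil_msize L n.
exists (fun j => (if j == i then q else 0) + g j); split=> [|j]; last first.
  by apply: (filD fm) => //; case: eqP; rewrite ?msize0.
under eq_bigr do rewrite mulrDr.
rewrite big_split /= gE; congr (_ + _).
rewrite (bigD1 i) //= eqxx big1 ?addr0 // => j /negPf->.
by rewrite mulr0.
Qed.

(** * The linear system of the Nullstellensatz identity *)

Section IntegralSolution.
Variables (RR : realType) (R : idomainType) (theta : nat -> nat) (h : R -> RR).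
Hypothesis h_type : height_of_type theta h.
Variable b : nat.
Hypothesis hN1 : h (-1) <= b%:R.
Variables (L : closedFieldType) (phi : {rmorphism R -> L}).
Hypothesis phi_inj : injective phi.
Variables (n d s : nat) (f : 'I_s -> {mpoly R[n]}).
Hypothesis fd : forall i, (msize (f i) <= d.+1)%N.
Hypothesis fb : forall i m, m \in msupp (f i) -> h (f i)@_m <= b%:R.
Hypothesis f_nz : forall x, exists i, (map_mpoly phi (f i)).@[x] != 0.

Let c := nullstellensatz_degree n d.
Let row_index : finType := ('I_s * 'X_{1..n < c.+1})%type.
Let col_index : finType := 'X_{1..n < (d + c).+1}.
Let K := #|{: col_index}|.
Let level := (6 + 3 * K + K`!)%N.

Let row_mon (i : 'I_#|{: row_index}|) : row_index := enum_val i.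
Let col_mon (j : 'I_#|{: col_index}|) : col_index := enum_val j.

(** Macaulay matrix: the row of (i, m) lists the coefficients of [f i] times the monomial m, so row
    combinations are sums of the [f i] times polynomials of degree at most [c]. The target [u] is
    the polynomial 1. *)
Let A : 'M[R]_(#|{: row_index}|, #|{: col_index}|) :=
  \matrix_(i, j) (f (row_mon i).1 * 'X_[(row_mon i).2])@_(col_mon j).
Let u : 'rV[R]_#|{: col_index}| := \row_j (bmnm (col_mon j) == 0%MM)%:R.

(** A nonzero entry is a coefficient of some [f i], at level 0; zero entries are placed at level
    2. *)
Lemma height_level_macaulay i j : height_level theta h b 2 (A i j).
Proof.
rewrite mxE; set m := bmnm (row_mon i).2; set m' := bmnm (col_mon j).
set p := f _.
have [m'p|/memN_msupp_eq0->] := boolP (m' \in msupp (p * 'X_[m])); last first.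
  exact: (height_level0 h_type).
move: m'p; rewrite (perm_mem (msuppMX _ _)) => /mapP[m0 m0p ->].
rewrite mcoeffMX; apply: (height_level_mono (j := 0)) => //.
exact: fb.
Qed.

Lemma macaulay_solvable : (map_mx phi u <= map_mx phi A)%MS.
Proof.
have [|x|G [GE Gc]] := @nullstellensatz_family L n d s (fun i => map_mpoly phi (f i)).
- move=> i; apply: leq_trans (fd i).
  rewrite msizeE; apply/bigmax_leqP_seq => m mp _; apply: msize_mdeg_lt.
  move: mp; rewrite !mcoeff_msupp mcoeff_map_mpoly.
  by apply: contraNneq => ->; apply/eqP/rmorph0.
- by have [i fi] := f_nz x; exists i.
apply/submxP; exists (\row_i (G (row_mon i).1)@_(row_mon i).2).
apply/rowP => j; rewrite !mxE rmorph_nat.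
have /(congr1 (mcoeff (col_mon j))) := GE; rewrite mcoeff1 => <-.
under [RHS]eq_bigr do rewrite !mxE.
rewrite -(reindex (P := xpredT) (F := fun x : row_index =>
   (G x.1)@_x.2 * phi ((f x.1 * 'X_[x.2])@_(col_mon j))) enum_val) /=; last first.
  by exists enum_rank => ? _; rewrite (enum_valK, enum_rankK).
rewrite -(pair_bigA _ (fun i (m : 'X_{1..n < c.+1}) =>
   (G i)@_m * phi ((f i * 'X_[m])@_(col_mon j)))) /= raddf_sum.
apply: eq_bigr => i _.
rewrite [X in _ * X](mpolywE (k := c.+1)) // mulr_sumr raddf_sum.
apply: eq_bigr => m _ /=.
rewrite -scalerAr mcoeffZ; congr (_ * _).
by rewrite -mcoeff_map_mpoly rmorphM /= map_mpolyX.
Qed.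

Lemma integral_solution : exists (a : R) (g : 'I_s -> {mpoly R[n]}),
  [/\ a != 0, a%:MP = \sum_i f i * g i,
      forall i, (msize (g i) <= c.+1)%N,
      height_level theta h b level a &
      forall i m, height_level theta h b level (g i)@_m].
Proof.
have [r [fr [gc [rK detB solB]]]] := cramer_minor phi_inj macaulay_solvable.
set B := mxsub fr gc A in detB solB.
(* [rowsub fr 1%:M] places the entries of [w] at the rows picked by [fr] and zeros at all others. *)
pose w := colsub gc u *m \adj B; pose v := w *m rowsub fr 1%:M.
have vA : v *m A = \det B *: u by rewrite -solB /v -mulmxA -rowsubE.
have hB i j : height_level theta h b 2 (B i j).
  by rewrite mxE; apply: height_level_macaulay.
have rfact : (r`! <= K`!)%N by exact: leq_fact.
(* Entries of [B] have level 2; a cofactor adds r + 2 + r!, the product with an entry of [u] adds 1,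
   the sum adds r. *)
pose l := (2 + r + 2 + r`! + 1 + r)%N.
have hw i : height_level theta h b l (w 0 i).
  rewrite mxE; apply: (height_level_sum_ord h_type hN1) => [|j]; first lia.
  rewrite addn1; apply: (height_levelM h_type).
    by rewrite !mxE; apply: (height_level_natb h_type hN1); lia.
  by rewrite mxE; apply: (height_level_cofactor h_type hN1).
have hv i : height_level theta h b level (v 0 i).
  have : height_level theta h b (l.+1 + r) (v 0 i).
    rewrite mxE; apply: (height_level_sum_ord h_type hN1) => [|j]; first lia.
    apply: (height_levelM h_type) => //.
    by rewrite !mxE; apply: (height_level_natb h_type hN1); lia.
  apply: (height_level_mono (j := l.+1 + r)); rewrite /level /l; lia.
exists (\det B), (fun i => \sum_(m : 'X_{1..n < c.+1})
  v 0 (enum_rank ((i, m) : row_index)) *: 'X_[m]).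
have gc_le i : (msize (\sum_(m : 'X_{1..n < c.+1})
    v 0 (enum_rank ((i, m) : row_index)) *: 'X_[m]) <= c.+1)%N.
  apply: (fil_sum (fil_msize R n)) => m _.
  by apply: leq_trans (msizeZ_le _ _) _; rewrite msizeX bmdeg.
split=> //.
- apply/mpolyP => m; rewrite mcoeffC.
  (* Monomials of degree above d + c have no column in [A], but both sides have coefficient 0
     there. *)
  have [md|md] := ltnP (mdeg m) (d + c).+1; last first.
    have -> : (m == 0%MM) = false.
      by apply: contraTF md => /eqP->; rewrite mdeg0.
    rewrite mulr0; apply/esym/memN_msupp_eq0/msize_mdeg_ge; apply: leq_trans md.
    apply: (fil_sum (fil_msize R n)) => i _.
    exact: (filM (fil_msize R n)).
  have /rowP/(_ (enum_rank (BMultinom md : col_index))) := vA.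
  rewrite !mxE /col_mon enum_rankK /= => <-.
  under [LHS]eq_bigr do rewrite [A _ _]mxE /row_mon /col_mon enum_rankK /=.
  rewrite (reindex (fun x : row_index => enum_rank x)) /=; last first.
    by exists enum_val => ? _; rewrite (enum_valK, enum_rankK).
  under [LHS]eq_bigr do rewrite enum_rankK.
  rewrite raddf_sum (eq_bigr (fun x : row_index =>
    v 0 (enum_rank ((x.1, x.2) : row_index)) * (f x.1 * 'X_[x.2])@_m)); last by case.
  rewrite -(pair_bigA _ (fun i (m' : 'X_{1..n < c.+1}) =>
     v 0 (enum_rank ((i, m') : row_index)) * ((f i * 'X_[m'])@_m))) /=.
  apply: eq_bigr => i _; rewrite mulr_sumr raddf_sum; apply: eq_bigr => m' _ /=.
  by rewrite -scalerAr mcoeffZ.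
- have := height_level_det h_type hN1 (leqnn 2) hB.
  by apply: height_level_mono; rewrite /level; lia.
move=> i m; rewrite raddf_sum /=.
have [md|md] := ltnP (mdeg m) c.+1.
  rewrite (bigD1 (BMultinom md)) //= mcoeffZ mcoeffX eqxx mulr1 big1 ?addr0 //.
  by move=> m'; rewrite mcoeffZ mcoeffX -val_eqE /= => /negPf->; rewrite mulr0.
rewrite big1 => [|m' _].
  by apply: (height_level_natb h_type hN1 false); rewrite /level; lia.
rewrite mcoeffZ mcoeffX; case: eqP => [mm'|]; rewrite ?mulr0 //.
by have := bmdeg m'; rewrite mm' ltnNge md.
Qed.

End IntegralSolution.

(** * Unique factorization and gcds *)

Lemma divides_trans (R : idomainType) (x y z : R) :
  divides x y -> divides y z -> divides x z.
Proof. by move=> [k ->] [l ->]; exists (l * k); rewrite mulrA. Qed.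

Section UniqueFactorization.
Variable R : idomainType.
Hypothesis ufd : is_ufd R.

Lemma prime_irreducible (p : R) : prime_elt p -> irreducible_elt p.
Proof.
move=> [p0 pU p_prime]; split=> // a b pab.
have /p_prime[[c aE]|[c bE]] : divides p (a * b) by exists 1; rewrite mul1r.
  right; apply/unitrPr; exists c; apply: (mulIf p0).
  by rewrite mul1r -mulrA -aE mulrC.
left; apply/unitrPr; exists c; apply: (mulIf p0).
by rewrite mul1r -mulrA -bE.
Qed.

Lemma unit_mul_factorization (x : R) : x != 0 ->
  exists u s, [/\ u \is a GRing.unit, forall p, p \in s -> irreducible_elt p &
    x = u * \prod_(p <- s) p].
Proof.
move=> x0; have [xU|xU] := boolP (x \is a GRing.unit).
  by exists x, [::]; split=> //; rewrite big_nil mulr1.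
have [s irr_s xE] := ufd.1 x x0 xU.
by exists 1, s; split=> //; rewrite ?unitr1 // mul1r.
Qed.

Lemma irreducible_unitM (u p : R) : u \is a GRing.unit ->
  irreducible_elt p -> irreducible_elt (u * p).
Proof.
move=> uU [p0 pU p_irr]; split.
- by rewrite mulf_neq0 //; apply: contraTneq uU => ->; rewrite unitr0.
- by rewrite unitrMr.
move=> a b uE; have [] := p_irr (u^-1 * a) b; first by rewrite -mulrA -uE mulKr.
  by rewrite unitrMr ?unitrV //; left.
by right.
Qed.

Lemma divides_prod_mem (q : R) (s : seq R) : q \in s ->
  divides q (\prod_(p <- s) p).
Proof.
by move=> qs; exists (\prod_(p <- rem q s) p); rewrite (big_rem q) //= mulrC.
Qed.

Lemma irreducible_prime (p : R) : irreducible_elt p -> prime_elt p.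
Proof.
move=> irr_p; have [p0 pU _] := irr_p; split=> // a b [c abE].
have [->|a0] := eqVneq a 0; first by left; exists 0; rewrite mul0r.
have [->|b0] := eqVneq b 0; first by right; exists 0; rewrite mul0r.
have c0 : c != 0.
  by apply: contraNneq (mulf_neq0 a0 b0) => c0; rewrite abE c0 mul0r.
have [ua [sa [uaU irr_a aE]]] := unit_mul_factorization a0.
have [ub [sb [ubU irr_b bE]]] := unit_mul_factorization b0.
have [uc [sc [ucU irr_c cE]]] := unit_mul_factorization c0.
have uU : ((ua * ub)^-1 * uc) \is a GRing.unit by rewrite !(unitrM, unitrV) uaU ubU.
(* [is_ufd] compares products without unit factors, so the unit is absorbed into [p] at the head of
   the list. The factor matched with index 0 is a multiple of [p] and lies in [sa] or [sb]. *)
have [] := ufd.2 (((ua * ub)^-1 * uc * p) :: sc) (sa ++ sb).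
- move=> q; rewrite inE => /predU1P[->|]; last exact: irr_c.
  exact: irreducible_unitM.
- by move=> q; rewrite mem_cat => /orP[]; [apply: irr_a | apply: irr_b].
- rewrite big_cons big_cat /=; apply: (mulrI (x := ua * ub)).
    by rewrite unitrM uaU.
  rewrite !mulrA divrr ?mul1r; last by rewrite unitrM uaU.
  rewrite mulrAC -[uc * _ * _]/(uc * _ * p) -cE -abE aE bE.
  by rewrite !mulrA [ua * ub * _]mulrAC.
move=> t' [perm_t' size_t' /(_ 0%N isT) /= [u uU' t'0]].
have p_dvd : divides p t'`_0.
  by exists (u * ((ua * ub)^-1 * uc)); rewrite t'0 !mulrA.
have: t'`_0 \in sa ++ sb by rewrite (perm_mem perm_t') mem_nth // -size_t'.
rewrite mem_cat => /orP[] /divides_prod_mem/(divides_trans p_dvd)[k kE].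
  by left; exists (ua * k); rewrite aE kE mulrA.
by right; exists (ub * k); rewrite bE kE mulrA.
Qed.

Lemma prime_divisor (x : R) : x != 0 -> x \isn't a GRing.unit ->
  exists2 p, prime_elt p & divides p x.
Proof.
move=> x0 xU; have [[|p s] irr_s xE] := ufd.1 x x0 xU.
  by move: xU; rewrite xE big_nil unitr1.
exists p; first by apply: irreducible_prime; apply: irr_s; rewrite mem_head.
by rewrite xE; apply: divides_prod_mem; rewrite mem_head.
Qed.

Lemma prime_divides_prod (p : R) (s : seq R) : prime_elt p ->
  divides p (\prod_(q <- s) q) -> exists2 q, q \in s & divides p q.
Proof.
move=> [p0 pU p_prime]; elim: s => [|q s IHs].
  rewrite big_nil => -[c cE]; case/negP: pU; apply/unitrPr.
  by exists c; rewrite mulrC.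
rewrite big_cons => /p_prime[|/IHs[q' q's]]; first by exists q; rewrite ?mem_head.
by exists q' => //; rewrite inE q's orbT.
Qed.

Lemma prime_dividesX (p q : R) k : prime_elt p -> divides p (q ^+ k) -> divides p q.
Proof.
move=> pp; rewrite -[k]card_ord -prodr_const -(big_map (fun=> q) xpredT id).
by case/(prime_divides_prod pp) => q' /mapP[? _ ->].
Qed.

Lemma divides_unitl (p u x : R) : u \is a GRing.unit ->
  divides p (u * x) -> divides p x.
Proof.
by move=> uU [c cE]; exists (u^-1 * c); rewrite -mulrA -cE mulKr.
Qed.

Lemma irreducible_divides (p q : R) : irreducible_elt q ->
  p \isn't a GRing.unit -> divides p q -> associated p q.
Proof.
move=> [_ _ q_irr] pU [c cE]; exists c => //.
by case: (q_irr _ _ cE) => // /(negP pU).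
Qed.

(** Induction on the number of irreducible factors of [a]. If the elements of [S] share a nonunit
    divisor, they share a prime divisor p. The set of all x with [S (x * p)] contains the quotient
    of [a] by p, which has one factor less, and its content times p is that of [S]. *)
Lemma exists_content (S : R -> Prop) (a : R) : a != 0 -> S a ->
  exists d, [/\ d != 0, forall x, S x -> divides d x &
    forall e, (forall x, S x -> divides (e * d) x) -> e \is a GRing.unit].
Proof.
move=> a0; have [u [s [uU irr_s aE]]] := unit_mul_factorization a0.
elim: {s}(size s).+1 {-2}s (ltnSn (size s)) => // k IHk s sk in S a a0 u uU irr_s aE *.
move=> Sa.
have [unit_dvd|] := pselect (forall e, (forall x, S x -> divides e x) ->
    e \is a GRing.unit).
  exists 1; split=> [|x _|e]; first exact: oner_neq0.
    by exists x; rewrite mulr1.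
  by rewrite mulr1; apply: unit_dvd.
move=> /existsNP[e /not_implyP[eS /negP eU]].
have e0 : e != 0.
  by apply: contraNneq a0 => e0; have [c ->] := eS a Sa; rewrite e0 mulr0.
have [p pp [e' eE]] := prime_divisor e0 eU.
have pS x : S x -> divides p x.
  by move=> /eS[c ->]; exists (c * e'); rewrite -mulrA -eE.
have [p0 pU _] := pp.
have [q qs pq] : exists2 q, q \in s & divides p q.
  by apply: (prime_divides_prod pp); apply: divides_unitl uU _; rewrite -aE; apply: pS.
have [c cU qE] := irreducible_divides (irr_s _ qs) pU pq.
pose a' := u * c * \prod_(x <- rem q s) x.
have aE' : a = a' * p.
  by rewrite /a' aE (big_rem q) //= qE -!mulrA; congr (_ * (_ * _)); rewrite mulrC.
have [d' [d'0 d'S d'U]] : exists d, [/\ d != 0,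
    forall x, S (x * p) -> divides d x &
    forall e, (forall x, S (x * p) -> divides (e * d) x) -> e \is a GRing.unit].
  apply: (IHk (rem q s) _ (fun x => S (x * p)) a' _ (u * c)).
  - by rewrite size_rem //; case: (s) qs sk.
  - by apply: contraNneq a0 => a'0; rewrite aE' a'0 mul0r.
  - by rewrite unitrM uU.
  - by move=> x /mem_rem/irr_s.
  - by [].
  - by rewrite -aE'.
exists (d' * p); split=> [|x Sx|e2 e2S]; first by rewrite mulf_neq0.
  have [y yE] := pS x Sx; have [z zE] : divides d' y by apply: d'S; rewrite -yE.
  by exists z; rewrite yE zE mulrA.
apply: d'U => x /e2S[y yE]; exists y; apply: (mulIf p0).
by rewrite yE -!mulrA.
Qed.

End UniqueFactorization.

(** * Coprime solutions for an absolute value *)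

Lemma exprn_small (RR : realType) (x M : RR) : 0 <= x -> x < 1 ->
  exists k, x ^+ k * M <= 1.
Proof.
move=> x0 x1; have [M0|M0] := leP M 0.
  by exists 0%N; rewrite expr0 mul1r (le_trans M0).
have [->|xn0] := eqVneq x 0; first by exists 1%N; rewrite mul0r.
have xp : 0 < x by rewrite lt_def xn0.
(* Bernoulli's inequality for the powers of 1 + y makes the powers of the inverse of [x] exceed
   [M]. *)
have [y [y0 yE]] : exists y, 0 < y /\ x^-1 = 1 + y.
  by exists (x^-1 - 1); rewrite subr_gt0 invf_gt1 // addrC subrK.
have bernoulli k : 1 + k%:R * y <= x^-1 ^+ k.
  elim: k => [|k IHk]; first by rewrite mul0r addr0.
  rewrite exprSr; apply: le_trans (ler_wpM2r _ IHk); last by rewrite invr_ge0.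
  rewrite yE -subr_ge0 -natr1.
  have -> : (1 + k%:R * y) * (1 + y) - (1 + (k%:R + 1) * y) = k%:R * y ^+ 2.
    by ring.
  by rewrite mulr_ge0 // sqr_ge0.
exists (Num.bound (M / y)).
have: M / y < (Num.bound (M / y))%:R by apply: archi_boundP; rewrite divr_ge0 // ltW.
rewrite ltr_pdivrMr // => Mk.
rewrite mulrC -ler_pdivlMr ?exprn_gt0 // mul1r -exprVn.
by apply: le_trans (bernoulli _); rewrite (le_trans (ltW Mk)) // lerDr ler01.
Qed.

Lemma is_gcd1P (R : idomainType) (S : R -> Prop) :
  (forall e, (forall x, S x -> divides e x) -> e \is a GRing.unit) -> is_gcd S 1.
Proof.
move=> S_unit; split=> [x _|e /S_unit eU]; first by exists x; rewrite mulr1.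
by exists e^-1; rewrite mulVr.
Qed.

Lemma mpoly_divides (R : idomainType) n (p : {mpoly R[n]}) d :
  (forall m, m \in msupp p -> divides d p@_m) -> exists q, p = d *: q.
Proof.
move=> dp; have /choice[y yE] : forall m, exists y, m \in msupp p -> p@_m = y * d.
  move=> m; have [/dp[y ->]|_] := boolP (m \in msupp p); first by exists y.
  by exists 0.
exists (\sum_(m <- msupp p) y m *: 'X_[m]); rewrite {1}[p]mpolyE scaler_sumr.
by apply: eq_big_seq => m mp; rewrite scalerA mulrC -yE.
Qed.

Section ShiftedSum.
Variables (R : idomainType) (n : nat) (M : 'X_{1..n}) (p q : {mpoly R[n]}).
Hypothesis pM : (msize p <= mdeg M)%N.

Lemma mcoeff_shifted_low m : (mdeg m < mdeg M)%N -> (p + q * 'X_[M])@_m = p@_m.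
Proof.
move=> mM; rewrite mcoeffD [X in _ + X]memN_msupp_eq0 ?addr0 //.
rewrite (perm_mem (msuppMX _ _)); apply/negP => /mapP[m' _ mE].
by move: mM; rewrite mE mdegD ltnNge leq_addr.
Qed.

Lemma mcoeff_shifted_high m : (p + q * 'X_[M])@_(M + m) = q@_m.
Proof.
rewrite mcoeffD mcoeffMX memN_msupp_eq0 ?add0r // msize_mdeg_ge // mdegD.
exact: leq_trans pM (leq_addr _ _).
Qed.

(** [p] lives in degrees below that of [M], the shifted [q] in degrees from it on, so every
    coefficient of the sum comes from one of the two or is 0. *)
Lemma mcoeff_shiftedP (P : R -> Prop) : P 0 ->
    (forall m, P p@_m) -> (forall m, P q@_m) ->
  forall m, P (p + q * 'X_[M])@_m.
Proof.
move=> P0 Pp Pq m; have [mM|mM] := ltnP (mdeg m) (mdeg M).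
  by rewrite mcoeff_shifted_low.
rewrite mcoeffD [p@_m]memN_msupp_eq0 ?add0r; last first.
  by rewrite msize_mdeg_ge // (leq_trans pM).
have [mq|/memN_msupp_eq0->//] := boolP (m \in msupp (q * 'X_[M])).
move: mq; rewrite (perm_mem (msuppMX _ _)) => /mapP[m' _ ->].
by rewrite mcoeffMX.
Qed.

End ShiftedSum.

Section CoprimeSolution.
Variables (RR : realType) (R : idomainType) (v : R -> RR).
Hypothesis v_prop : ufd_with_p_property v.

Let ufd : is_ufd R. Proof. by case: v_prop. Qed.
Let v_ge0 x : 0 <= v x. Proof. by case: v_prop => _ []. Qed.
Let v_eq0 x : v x = 0 <-> x = 0. Proof. by case: v_prop => _ []. Qed.
Let vM x y : v (x * y) = v x * v y. Proof. by case: v_prop => _ []. Qed.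
Let v_unit u : u \is a GRing.unit -> v u = 1.
Proof. by case: v_prop => _ _ H _; apply: H. Qed.
Let v0 : v 0 = 0. Proof. exact/v_eq0. Qed.
Let v1 : v 1 = 1. Proof. exact/v_unit/unitr1. Qed.
Let vX x k : v (x ^+ k) = v x ^+ k.
Proof. by elim: k => [|k IHk]; rewrite ?v1 // !exprS vM IHk. Qed.
Let vN x : v (- x) = v x.
Proof. by rewrite -mulN1r vM v_unit ?mul1r // unitrN1. Qed.
Let v_gt0 x : x != 0 -> 0 < v x.
Proof. by move=> x0; rewrite lt_def v_ge0 andbT; apply: contra_neq x0 => /v_eq0. Qed.

Lemma absval_ge1 : (forall p, prime_elt p -> 1 <= v p) ->
  forall x, x != 0 -> 1 <= v x.
Proof.
move=> v_pr x /(unit_mul_factorization ufd)[u [s [uU irr_s ->]]].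
rewrite vM v_unit // mul1r; elim: s irr_s => [|p s IHs] irr_s.
  by rewrite big_nil v1.
rewrite big_cons vM mulr_ege1 //.
  by apply: v_pr; apply: (irreducible_prime ufd); apply: irr_s; rewrite mem_head.
by apply: IHs => q qs; apply: irr_s; rewrite inE qs orbT.
Qed.

Lemma absval_le1 : (forall p, prime_elt p -> v p <= 1) -> forall x, v x <= 1.
Proof.
move=> v_pr x; have [->|] := eqVneq x 0; first by rewrite v0.
move=> /(unit_mul_factorization ufd)[u [s [uU irr_s ->]]].
rewrite vM v_unit // mul1r; elim: s irr_s => [|p s IHs] irr_s.
  by rewrite big_nil v1.
rewrite big_cons vM mulr_ile1 //.
  by apply: v_pr; apply: (irreducible_prime ufd); apply: irr_s; rewrite mem_head.
by apply: IHs => q qs; apply: irr_s; rewrite inE qs orbT.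
Qed.

(** The p-property enters here: a prime below 1 and a prime above 1 yield a second, non-associated
    prime below 1. *)
Lemma absval_trichotomy : [\/ forall p, prime_elt p -> 1 <= v p,
  forall p, prime_elt p -> v p <= 1 |
  exists p r, [/\ prime_elt p, prime_elt r, ~ associated p r, v p < 1 & v r < 1]].
Proof.
have [?|/existsNP[p /not_implyP[pp /negP]]] :=
  pselect (forall p, prime_elt p -> 1 <= v p); first by constructor 1.
rewrite -ltNge => vp.
have [?|/existsNP[q /not_implyP[qq /negP]]] :=
  pselect (forall p, prime_elt p -> v p <= 1); first by constructor 2.
rewrite -ltNge => vq; constructor 3.
case: v_prop => _ _ _ /(_ p q pp qq vp vq)[r [rr npr vr]].
by exists p, r.
Qed.

Variables (n s : nat) (f : 'I_s -> {mpoly R[n]}).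

Definition solution_elts (a : R) (g : 'I_s -> {mpoly R[n]}) (x : R) : Prop :=
  x = a \/ exists i m, m \in msupp (g i) /\ x = (g i)@_m.

Lemma divides_solution a g e :
    (forall x, solution_elts a g x -> divides e x) ->
  divides e a /\ forall i m, divides e (g i)@_m.
Proof.
move=> eS; split; first by apply: eS; left.
move=> i m; have [mg|/memN_msupp_eq0->] := boolP (m \in msupp (g i)).
  by apply: eS; right; exists i, m.
by exists 0; rewrite mul0r.
Qed.

Lemma primitive_solution a g :
    a != 0 -> a%:MP = \sum_i f i * g i ->
  exists d a' g', [/\ d != 0, a = d * a', forall i, g i = d *: g' i,
    a'%:MP = \sum_i f i * g' i &
    forall e, (divides e a' /\ forall i m, divides e (g' i)@_m) ->
      e \is a GRing.unit].
Proof.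
move=> a0 agE; have [|d [d0 dS dU]] := exists_content ufd (S := solution_elts a g) a0.
  by left.
have [[a' aE] dg] := divides_solution dS.
have /choice[g' gE] : forall i, exists q, g i = d *: q.
  by move=> i; apply: mpoly_divides => m _; apply: dg.
exists d, a', g'; split=> //; first by rewrite mulrC.
  apply/mpolyP => m; apply: (mulfI d0).
  have /(congr1 (mcoeff m)) := agE; rewrite aE !mcoeffC mulrA [d * a']mulrC => ->.
  rewrite -mcoeffZ scaler_sumr; congr (_ @_ m).
  by apply: eq_bigr => i _; rewrite gE scalerAr.
move=> e [[y yE] eg]; apply: dU => x [->|[i [m [_ ->]]]].
  by exists y; rewrite aE yE mulrA.
have [z zE] := eg i m; exists z; rewrite gE mcoeffZ zE.
by rewrite mulrC mulrA.
Qed.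

Variables (a : R) (g : 'I_s -> {mpoly R[n]}) (c D : nat) (C : RR).
Hypotheses (n_gt0 : (0 < n)%N) (C_ge1 : 1 <= C).
Hypothesis fD : forall i, (msize (f i) <= D.+1)%N.
Hypothesis a_nz : a != 0.
Hypothesis agE : a%:MP = \sum_i f i * g i.
Hypothesis gc : forall i, (msize (g i) <= c.+1)%N.
Hypothesis va : v a <= C.
Hypothesis vg : forall i m, v (g i)@_m <= C.
Hypothesis vf : forall i m, v (f i)@_m <= C.
Variables i0 i1 : 'I_s.
Hypothesis i01 : i1 != i0.
Hypothesis f0_nz : f i0 != 0.

(* Two small non-associated primes [p], [r] make every height at most 1:
   scale the primitive solution by a power of [p], and add, in degrees beyond
   those of the solution, a power of [r] times a primitive multiple of the
   syzygy [(f_1, - f_0)].  A common prime divisor divides both [p] and [r]. *)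
Lemma coprime_solution : exists a' g',
  [/\ a' != 0, a'%:MP = \sum_i f i * g' i,
      forall i, (msize (g' i) <= (c + D + 1).+1)%N,
      v a' <= C /\ forall i m, v (g' i)@_m <= C &
      is_gcd (solution_elts a' g') 1].
Proof.
have [d [a' [g' [d0 aE gE agE' prim]]]] := primitive_solution a_nz agE.
have a'0 : a' != 0 by apply: contraNneq a_nz => a'0; rewrite aE a'0 mulr0.
have vd : 0 < v d by apply: v_gt0.
have g'c i : (msize (g' i) <= c.+1)%N by rewrite -(msizeZ (g' i) d0) -gE.
have va' : v a' <= C / v d by rewrite ler_pdivlMr // mulrC -vM -aE.
have vg' i m : v (g' i)@_m <= C / v d.
  by rewrite ler_pdivlMr // mulrC -vM -mcoeffZ -gE.
(* In the first alternative the primitive solution itself is small enough; the second supplies two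
   small primes. *)
suff [[va1 vg1]|[p [r [pp rr npr vp vr]]]] :
    (v a' <= C /\ forall i m, v (g' i)@_m <= C) \/
    exists p r, [/\ prime_elt p, prime_elt r, ~ associated p r, v p < 1 & v r < 1].
- exists a', g'; split=> //.
    by move=> i; apply: leq_trans (g'c i) _; rewrite ltnS -addnA leq_addr.
  by apply: is_gcd1P => e /divides_solution; apply: prim.
(* [e] is the common content of [f i0] and [f i1]; dividing by it makes the syzygy primitive. *)
- have [e [e0 eS eU]] : exists e, [/\ e != 0, 
      forall x, (exists i m, (i = i0 \/ i = i1) /\ x = (f i)@_m) -> divides e x &
      forall e', (forall x, (exists i m, (i = i0 \/ i = i1) /\ x = (f i)@_m) ->
        divides (e' * e) x) -> e' \is a GRing.unit].
    apply: (exists_content ufd (a := (f i0)@_(mlead (f i0)))).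
      by rewrite mleadc_eq0.
    by exists i0, (mlead (f i0)); split=> //; left.
  have /choice[f' fE] : forall i, exists q, (i = i0 \/ i = i1) -> f i = e *: q.
    move=> i; have [ii|nii] := pselect (i = i0 \/ i = i1); last by exists 0.
    have [|q qE] := @mpoly_divides _ _ (f i) e; last by exists q.
    by move=> m _; apply: eS; exists i, m.
  have fE0 : f i0 = e *: f' i0 by apply: fE; left.
  have fE1 : f i1 = e *: f' i1 by apply: fE; right.
  have ve : 0 < v e by apply: v_gt0.
  have vf' i m : i = i0 \/ i = i1 -> v (f' i)@_m <= C / v e.
    by move=> ii; rewrite ler_pdivlMr // mulrC -vM -mcoeffZ -fE.
  have f'D i : i = i0 \/ i = i1 -> (msize (f' i) <= D.+1)%N.
    by move=> ii; rewrite -(msizeZ (f' i) e0) -fE.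
  have [k pk] := exprn_small (C / v d) (v_ge0 p) vp.
  have [l rl] := exprn_small (C / v e) (v_ge0 r) vr.
  pose t i := if i == i0 then r ^+ l *: f' i1
    else if i == i1 then - (r ^+ l *: f' i0) else 0.
  (* The degree c + 1 exceeds the degrees of all [g' i]. *)
  pose M : 'X_{1..n} := (U_(Ordinal n_gt0) *+ c.+1)%MM.
  have degM : mdeg M = c.+1 by rewrite mdegMn mdeg1 mul1n.
  pose G i := p ^+ k *: g' i + t i * 'X_[M].
  have p0 : p != 0 by case: pp.
  have r0 : r != 0 by case: rr.
  have Gc i : (msize (p ^+ k *: g' i) <= mdeg M)%N.
    by rewrite degM (leq_trans (msizeZ_le _ _)).
  have tD i : (msize (t i) <= D.+1)%N.
    rewrite /t; case: eqP => [_|_].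
      by rewrite (leq_trans (msizeZ_le _ _)) //; apply: f'D; right.
    case: eqP => [_|_]; last by rewrite msize0.
    by rewrite msizeN (leq_trans (msizeZ_le _ _)) //; apply: f'D; left.
  have small x y z : v x <= y -> v z * y <= 1 -> v (z * x) <= 1.
    by move=> xy; apply: le_trans; rewrite vM ler_wpM2l.
  have small_t i m : v (t i)@_m <= 1.
    rewrite /t; case: eqP => [_|_].
      by rewrite mcoeffZ; apply: small (vf' _ _ _) _; [right | rewrite vX].
    case: eqP => [_|_]; last by rewrite mcoeff0 v0.
    by rewrite mcoeffN vN mcoeffZ; apply: small (vf' _ _ _) _; [left | rewrite vX].
  exists (p ^+ k * a'), G; split.
  + by rewrite mulf_neq0 // expf_neq0.
  + under eq_bigr do rewrite mulrDr.
    rewrite big_split /= -[LHS]addr0; congr (_ + _).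
      rewrite mpolyCM mul_mpolyC agE' scaler_sumr; apply: eq_bigr => i _.
      by rewrite scalerAr.
    under eq_bigr do rewrite mulrA.
    rewrite -big_distrl /= (bigD1 i0) //= (bigD1 i1) //= big1 ?addr0.
      rewrite /t eqxx (negPf i01) eqxx fE0 fE1 mulrN -!scalerAl -!scalerAr.
      by rewrite [f' i1 * _]mulrC subrr mul0r.
    by move=> i /andP[/negPf ni0 /negPf ni1]; rewrite /t ni0 ni1 mulr0.
  + move=> i; apply: (filD (fil_msize R n)).
      by rewrite (leq_trans (Gc i)) // degM ltnS -addnA leq_addr.
    have -> : (c + D + 1 = D + c.+1)%N by rewrite addn1 addnS addnC.
    by apply: (filM (fil_msize R n)); rewrite ?tD // msizeX degM.
  + split.
      by apply: le_trans C_ge1; apply: small va' _; rewrite vX.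
    move=> i m; apply: (mcoeff_shiftedP (Gc i) (P := fun x => v x <= C)).
    * by rewrite v0 (le_trans ler01).
    * move=> m'; rewrite mcoeffZ; apply: le_trans C_ge1.
      by apply: small (vg' _ _) _; rewrite vX.
    * by move=> m'; apply: le_trans C_ge1; apply: small_t.
  apply: is_gcd1P => x /divides_solution[xa xG].
  have x0 : x != 0.
    apply/eqP => x0; have [y yE] := xa; move: yE; rewrite x0 mulr0.
    by apply/eqP; rewrite mulf_neq0 // expf_neq0.
  have [//|xU] := boolP (x \is a GRing.unit).
  have [q qq qx] := prime_divisor ufd x0 xU.
  have [q0 qU q_prime] := qq.
  have qa := divides_trans qx xa.
  have qG i m := divides_trans qx (xG i m).
  (* Otherwise [q] divides [a'] and, by the low-degree coefficients, all those of [g'], against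
     [prim]. *)
  have qp : divides q p.
    apply: contrapT => nqp; case/negP: qU; apply: prim.
    have nqX y : divides q (p ^+ k * y) -> divides q y.
      by move/q_prime => [/(prime_dividesX qq)|].
    split=> [|i m]; first exact: nqX.
    have [mM|mM] := ltnP (mdeg m) (mdeg M).
      by apply: nqX; have := qG i m; rewrite /G mcoeff_shifted_low // mcoeffZ.
    rewrite memN_msupp_eq0; first by exists 0; rewrite mul0r.
    by rewrite msize_mdeg_ge // (leq_trans (g'c i)) // -degM.
  (* Otherwise the high-degree coefficients show that [q * e] divides all coefficients of [f i0] and
     [f i1], against [eU]. *)
  have qr : divides q r.
    apply: contrapT => nqr; case/negP: qU; apply: eU => _ [i [m [ii ->]]].
    have nqX y : divides q (r ^+ l * y) -> divides q y.
      by move/q_prime => [/(prime_dividesX qq)|].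
    suff [y yE] : divides q (f' i)@_m.
      by exists y; rewrite fE // mcoeffZ yE mulrCA [e * q]mulrC.
    have tq j : divides q (t j)@_m.
      by have := qG j (M + m)%MM; rewrite /G mcoeff_shifted_high.
    case: ii => ->.
      have := tq i1; rewrite /t (negPf i01) eqxx mcoeffN mcoeffZ => -[y yE].
      by apply: nqX; exists (- y); rewrite mulNr -yE opprK.
    by apply: nqX; have := tq i0; rewrite /t eqxx mcoeffZ.
  have [w wU pE] := irreducible_divides (prime_irreducible pp) qU qp.
  have [w' w'U rE] := irreducible_divides (prime_irreducible rr) qU qr.
  case: npr; exists (w' * w^-1); first by rewrite unitrM w'U unitrV.
  by rewrite rE pE -mulrA mulKr.
have [v_pr|v_pr|] := absval_trichotomy; last by right.
- left; have Cd : C / v d <= C.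
    by rewrite ler_pdivrMr // ler_peMr ?(le_trans ler01) // absval_ge1.
  by split=> [|i m]; [apply: le_trans va' Cd | apply: le_trans (vg' i m) Cd].
- by left; split=> [|i m]; apply: le_trans C_ge1; apply: absval_le1.
Qed.

End CoprimeSolution.

(** * Assembly of the degree and height bounds *)

Lemma total_degree_le (R : idomainType) n (p : {mpoly R[n]}) d :
  (total_degree p <= d)%N = (msize p <= d.+1)%N.
Proof. by rewrite /total_degree; case: (msize p). Qed.

Lemma coef_poly_height (RR : realType) (R : idomainType) (h : R -> RR) n
    (p : {mpoly R[n]}) m :
  m \in msupp p -> h p@_m <= poly_height h p.
Proof. by move=> mp; rewrite /poly_height; apply: le_bigmax_seq. Qed.

Lemma poly_height_le (RR : realType) (R : idomainType) (h : R -> RR) n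
    (p : {mpoly R[n]}) (C : RR) :
  0 <= C -> (forall m, h p@_m <= C) -> poly_height h p <= C.
Proof. by move=> C0 hC; apply: bigmax_le. Qed.

Lemma mpolyC_mul_const (R : idomainType) n (a : R) (p q : {mpoly R[n]}) :
  a != 0 -> a%:MP = p * q -> exists2 k, k != 0 & p = k%:MP.
Proof.
move=> a0 aE; have [p0 q0] : p != 0 /\ q != 0.
  by apply/andP; rewrite -negb_or -mulf_eq0 -aE mpolyC_eq0.
apply/msize_poly1P.
have := congr1 (fun p : {mpoly R[n]} => msize p) aE; rewrite msizeC a0 msizeM // => pq.
by move: p0 q0; rewrite -!msize_poly_eq0; lia.
Qed.

Definition height_levels (n D : nat) : nat :=
  let K := #|{: 'X_{1..n < (D + nullstellensatz_degree n D).+1}}| in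
  6 + 3 * K + K`!.

(* [c1] and [c2] are chosen before the ring, the height and the polynomials.
   The argument [h (-1)] of [c2] cannot be dropped: nothing in the definition
   of theta-type bounds the height of [- x].  On the integers, let
   h x = x for x >= 0 and h x = M + |x| for x < 0; this is of theta-type for
   theta k = k ^ 2 + 3 * k whatever M is.  For f1 = X and f2 = X + 1, both of
   height 1, elements of height at most M are nonnegative, and
   X * h1 + (X + 1) * h2 is never a nonzero constant when h1 and h2 have
   nonnegative coefficients.  For an absolute value h (-1) = 1. *)
Theorem theoremA (RR : realType) :
  exists (c1 : nat -> nat -> nat)
         (c2 : nat -> nat -> nat -> (nat -> nat) -> RR -> RR),
  forall (R : idomainType) (theta : nat -> nat) (h : R -> RR),
    height_of_type theta h ->
  forall (L : closedFieldType) (iota : {rmorphism {fraction R} -> L}),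
    is_algebraic_closure iota ->
  forall n D H : nat, (1 <= n)%N -> (1 <= D)%N -> (1 <= H)%N ->
  forall (s : nat) (f : 'I_s -> {mpoly R[n]}),
    ~ (exists z : 'I_n -> L, common_zero iota f z) ->
    (forall i, (total_degree (f i) <= D)%N) ->
    (forall i, poly_height h (f i) <= H%:R) ->
  exists (a : R) (g : 'I_s -> {mpoly R[n]}),
    [/\ a != 0,
        a%:MP = \sum_(i < s) f i * g i,
        forall i, (total_degree (g i) <= c1 n D)%N,
        h a <= c2 n D H theta (h (-1)) /\
          (forall i, poly_height h (g i) <= c2 n D H theta (h (-1))) &
        ufd_with_p_property h ->
          is_gcd (fun x => x = a \/
                    exists i m, m \in msupp (g i) /\ x = (g i)@_m) 1].
Proof.
(* The extra D + 1 covers the syzygy, of degree at most D, times a monomial of degree one more than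
   the Nullstellensatz bound. In the second witness [Num.bound x] replaces the real number [h (-1)]
   by an integer above it. *)
exists (fun n D => nullstellensatz_degree n D + D + 1)%N.
exists (fun n D H theta x =>
  (height_bound theta (maxn H (Num.bound x)) (height_levels n D))%:R).
move=> R theta h h_type L iota _ n D H n_gt0 _ H_gt0 s f f_nz fD fH.
set c := nullstellensatz_degree n D; set b := maxn H _.
set C := (height_bound _ _ _)%:R.
have hN1 : h (-1) <= b%:R.
  apply: le_trans (ltW (archi_boundP (h_type.1 _))) _.
  by rewrite ler_nat leq_maxr.
have b_le_C : b%:R <= C by rewrite ler_nat (@leq_height_bound theta b 0).
have C_ge1 : 1 <= C.
  by apply: le_trans b_le_C; rewrite ler1n (leq_trans H_gt0) // leq_maxl.
have C_ge0 : 0 <= C := le_trans ler01 C_ge1.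
have fd i : (msize (f i) <= D.+1)%N.
  by rewrite -total_degree_le.
have fb i m : m \in msupp (f i) -> h (f i)@_m <= b%:R.
  move=> /coef_poly_height/le_trans; apply; apply: le_trans (fH i) _.
  by rewrite ler_nat leq_maxl.
pose phi : {rmorphism R -> L} := iota \o @tofrac R.
have phi_inj : injective phi.
  by move=> x y /fmorph_inj/eqP; rewrite tofrac_eq => /eqP.
have phi_nz x : exists i, (map_mpoly phi (f i)).@[x] != 0.
  apply: contrapT => no_i; apply: f_nz; exists x => i; apply/eqP.
  by apply: contrapT => /negP fi; apply: no_i; exists i.
have [a [g [a0 agE gc ha hg]]] := integral_solution h_type hN1 phi_inj fd fb phi_nz.
have [v_prop|no_prop] := pselect (ufd_with_p_property h); last first.
  exists a, g; split=> //.
    move=> i; rewrite total_degree_le; apply: leq_trans (gc i) _.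
    by rewrite ltnS -addnA leq_addr.
  by split=> [|i]; last (apply: poly_height_le => // m; apply: hg).
have [i0 fi0] := phi_nz (fun=> 0).
have f0_nz : f i0 != 0.
  by apply: contraNneq fi0 => ->; rewrite rmorph0 meval0 eqxx.
have [[i1 i01]|single] := pselect (exists i1, i1 != i0).
  have vf i m : h (f i)@_m <= C.
    have [/fb/le_trans|/memN_msupp_eq0->] := boolP (m \in msupp (f i)); first exact.
    by have [_ [_ v0 _ _] _ _] := v_prop; rewrite (v0 0).2.
  have [a' [g' [a'0 agE' g'c [ha' hg'] gcd1]]] :=
    coprime_solution v_prop n_gt0 C_ge1 fd a0 agE gc ha hg vf i01 f0_nz.
  exists a', g'; split=> //; first by move=> i; rewrite total_degree_le.
  by split=> // i; apply: poly_height_le.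
(* A single polynomial leaves no second one for a syzygy. It divides a nonzero constant, so it is
   itself a nonzero constant [k]; taking [k] with multiplier 1 makes the gcd 1. *)
have all_i0 i : i = i0.
  by apply/eqP/negPn/negP => ii; apply: single; exists i.
have sumE (F : 'I_s -> {mpoly R[n]}) : \sum_i F i = F i0.
  by rewrite (bigD1 i0) //= big1 ?addr0 // => i; rewrite (all_i0 i) eqxx.
have [k k0 fE] := mpolyC_mul_const a0 (etrans agE (sumE _)).
exists k, (fun=> 1); split=> //.
- by rewrite sumE mulr1.
- by move=> i; rewrite /total_degree msize1.
- have h1 : h 1 <= C.
    by have [_ _ vU _] := v_prop; rewrite vU ?unitr1.
  have h0 : h 0 <= C by have [_ [_ v0 _ _] _ _] := v_prop; rewrite (v0 0).2.
  split; last by move=> i; apply: poly_height_le => // m; rewrite mcoeff1; case: eqP.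
  apply: le_trans b_le_C; have := fb i0 0%MM; rewrite fE mcoeffC eqxx mulr1.
  by apply; rewrite msuppC (negPf k0) mem_head.
move=> _; apply: is_gcd1P => e /(_ 1)[|y yE].
  by right; exists i0, 0%MM; rewrite msupp1 mem_head mcoeff1 eqxx.
by apply/unitrPr; exists y; rewrite mulrC.
Qed.
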